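(* There is an absolute constant $C>0$ such that the following holds. Let $G$ be a uniformly random simple $d$-regular graph on $n$ vertices and let $C_k$ be the number of cycles of length $k$ in $G$. Let $(Z_k,\ k\geq 3)$ be independent Poisson random variables with $\mathbb{E}Z_k=(d-1)^k/(2k)$. For any $n\geq 1$ and $r,d\geq 3$, \[ d_{TV}\big((C_3,\dots,C_r),(Z_3,\dots,Z_r)\big)\leq \frac{C\sqrt{r}(d-1)^{3r/2-1}}{n}. \]
   Context: A random $d$-regular graph on $n$ vertices is chosen uniformly from all simple $d$-regular graphs on $\{1,\dots,n\}$ (with $n$ even when $d$ is odd). Cycles are simple cycles. For random vectors $X,Y$ with values in $\mathbb{N}^m$, $d_{TV}(X,Y)=\sup_{A\subset \mathbb{N}^m}|\mathbb{P}[X\in A]-\mathbb{P}[Y\in A]|$. *)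

(* Defs.v *)
From HB Require Import structures.
From mathcomp Require Import all_boot all_order all_algebra finmap.
From mathcomp Require Import all_classical all_reals all_analysis.

Set Implicit Arguments.
Unset Strict Implicit.
Unset Printing Implicit Defensive.

Import Order.TTheory GRing.Theory Num.Theory.

Section Graphs.
Local Open Scope set_scope.
Context (n : nat).

Definition sgraph := {E : {set {set 'I_n}} | [forall e in E, #|e| == 2]}.

Definition adj (G : sgraph) : rel 'I_n := fun x y => [set x; y] \in val G.

Definition regular_graph (d : nat) (G : sgraph) : bool :=
  [forall x, #|[set y | adj G x y]| == d].

Definition cycle_edges (c : seq 'I_n) : {set {set 'I_n}} :=
  [set [set x; next c x] | x in c].

(* A cycle is a subgraph, identified with its edge set, so the 2k rooted and
   oriented traversals of a k-cycle are counted once (for k >= 3). *)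
Definition ncycles (G : sgraph) (k : nat) : nat :=
  #|[set cycle_edges (tval c) | c : k.-tuple 'I_n & ucycleb (adj G) c]|.

End Graphs.

Section Probability.
Local Open Scope classical_set_scope.
Local Open Scope ereal_scope.
Context {R : realType}.

(* If no d-regular graph on n vertices exists, no G satisfies this. *)
Definition uniform_regular_graph {dT : measure_display} {T : measurableType dT}
    (P : probability T R) (n d : nat) (G : T -> sgraph n) : Prop :=
  forall g : sgraph n,
    measurable (G @^-1` [set g]) /\
    P (G @^-1` [set g]) =
      (if regular_graph d g then (#|[pred h : sgraph n | regular_graph d h]|%:R^-1)%:E else 0).

Definition has_Poisson_law {dT : measure_display} {T : measurableType dT}
    (P : probability T R) (rate : R) (X : {RV P >-> nat}) : Prop :=
  forall j : nat, P (X @^-1` [set j]) = (poisson_pmf rate j)%:E.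

Definition mutually_independent {dT : measure_display} {T : measurableType dT}
    (P : probability T R) (D : set nat) (X : nat -> {RV P >-> nat}) : Prop :=
  forall (J : {fset nat}) (A : nat -> set nat), [set` J] `<=` D ->
    P (\bigcap_(k in [set` J]) (X k @^-1` A k)) =
    \prod_(k <- J) P (X k @^-1` A k).

Definition dTV {d1 d2 : measure_display}
    {T1 : measurableType d1} {T2 : measurableType d2}
    (P1 : probability T1 R) (P2 : probability T2 R) (m : nat)
    (X : T1 -> {ffun 'I_m -> nat}) (Y : T2 -> {ffun 'I_m -> nat}) : \bar R :=
  ereal_sup [set `|P1 (X @^-1` A) - P2 (Y @^-1` A)| | A in [set: set {ffun 'I_m -> nat}]].

End Probability.

(* Main.v *)
Require Import Defs.
From HB Require Import structures.
From mathcomp Require Import all_boot zify.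

(** The proof is Stein's method for the Poisson law, driven by 2-switchings.

    A non-backtracking walk [u x_1 ... x_k v] of length [k + 1] in [G] is
    switched by deleting the edges [u x_1], [x_k v] and inserting [x_1 x_k],
    [u v]; if nothing degenerates, the k-cycle [x_1 ... x_k] is created and no
    other cycle of length at most [k] is created or destroyed.  A d-regular
    graph has exactly [n d (d-1)^k] such walks, while a graph with [C_k] cycles
    arises from at most [2 k C_k n d] switchings.  Comparing both counts,
    the ratio [(d-1)^k / (2 k)] emerges as the Poisson rate, and the error in
    the Stein equation is controlled by the expected number of bad walks.

    A walk is bad only if one of its segments lies on a short cycle, so the
    number of bad walks is bounded by expected numbers of cycles, and these in
    turn by the same switching applied in the reverse direction.

    The counts [C_3, ..., C_r] are replaced by Poisson variables one at a time,
    starting with [C_r]: the switching for [C_k] then has to preserve the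
    shorter counts only, and longer cycles may be created or destroyed. *)

Set Implicit Arguments.
Unset Strict Implicit.
Unset Printing Implicit Defensive.

Local Open Scope set_scope.
Local Open Scope nat_scope.

(** * Switchings *)

(** In the stage for [C_k] the longer counts are already averaged out and the shorter ones are
    frozen, so the Stein solution [g] depends on the shorter counts as well as on [C_k]. A good
    switching raises [C_k] by one and keeps the shorter counts; hence it matches the value of [g] at
    [C_k + 1] in the source graph with its value at the count of the target graph exactly. This is
    why the error involves only the supremum of [g], of order [lam ^ (-1/2)], and not its
    increments.

    With [lam = (d-1)^k / (2k)] this supremum is of order [sqrt k (d-1)^(-k/2)], and the unmatched
    switchings contribute [(d-1)^(2k-1) / n]. The product [sqrt k (d-1)^(3k/2-1) / n] grows
    geometrically in [k], so the stage [k = r] dominates and gives the exponent of the theorem. The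
    comparison needs [n] to exceed a multiple of [r + d]; for smaller [n] the claimed bound is at
    least 1. *)

Lemma eq_set2 (T : finType) (a b c e : T) :
  ([set a; b] == [set c; e]) =
    ((a == c) && (b == e)) || ((a == e) && (b == c)).
Proof.
apply/eqP/idP => [E|]; last first.
  by case/orP=> /andP[/eqP-> /eqP->] //; rewrite setUC.
have : a \in [set c; e] by rewrite -E !inE eqxx.
have : b \in [set c; e] by rewrite -E !inE eqxx orbT.
have : c \in [set a; b] by rewrite E !inE eqxx.
have : e \in [set a; b] by rewrite E !inE eqxx orbT.
rewrite !inE (eq_sym e a) (eq_sym e b) (eq_sym c a) (eq_sym c b).
by do 4!case: eqP => //=.
Qed.

Section Switch.
Context (n : nat).
Implicit Types (G : sgraph n) (Q : {set {set 'I_n}}) (a b c e x y : 'I_n).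

Lemma adj_sym G : symmetric (adj G).
Proof. by move=> x y; rewrite /adj setUC. Qed.

Lemma adj_irr G x : adj G x x = false.
Proof.
apply/negP => h; have /forall_inP /(_ _ h) := valP G.
by rewrite setUid cards1.
Qed.

Lemma adj_neq G x y : adj G x y -> x != y.
Proof. by apply: contraL => /eqP->; rewrite adj_irr. Qed.

(* Symmetric difference with Q; the filter discards members of Q that are not
   pairs, so that flip Q is an involution on graphs for every Q. *)
Definition flip_edges Q G : {set {set 'I_n}} :=
  [set f : {set 'I_n} | (#|f| == 2) && ((f \in val G) (+) (f \in Q))].

Lemma flip_edges2 Q G : [forall f in flip_edges Q G, #|f| == 2].
Proof. by apply/forall_inP => f; rewrite inE => /andP[]. Qed.

Definition flip Q G : sgraph n := Sub (flip_edges Q G) (flip_edges2 Q G).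

Lemma flipK Q : involutive (flip Q).
Proof.
move=> G; apply/val_inj/setP => f; rewrite !inE.
case: eqP => /= [_|f2]; first by rewrite -addbA addbb addbF.
apply/esym/negP => fG; apply: f2; apply/eqP.
by move: fG; have /forall_inP := valP G; apply.
Qed.

Lemma adj_flip Q G x y :
  adj (flip Q G) x y = (x != y) && (adj G x y (+) ([set x; y] \in Q)).
Proof. by rewrite /adj inE cards2; case: (x != y). Qed.

(** A 2-switching exchanges the two pairs of opposite sides of the 4-cycle [a b c e]. One set of
    four edges, toggled by [flip], thus encodes a switching together with its inverse. *)
Definition quad a b c e : {set {set 'I_n}} :=
  [set [set a; b]; [set b; c]; [set c; e]; [set e; a]].

Lemma in_quad a b c e x y : ([set x; y] \in quad a b c e) =
  [|| (x == a) && (y == b), (x == b) && (y == a),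
      (x == b) && (y == c), (x == c) && (y == b),
      (x == c) && (y == e), (x == e) && (y == c),
      (x == e) && (y == a) | (x == a) && (y == e)].
Proof. by rewrite !inE !eq_set2 -!orbA. Qed.

Lemma quad_rot a b c e : quad a b c e = quad b c e a.
Proof.
by apply/setP => f; rewrite !inE; do 4!case: (f == _).
Qed.

Lemma quad_flip a b c e : quad a b c e = quad b a e c.
Proof.
rewrite /quad (setUC [set b] [set a]) (setUC [set a] [set e]).
rewrite (setUC [set e] [set c]) (setUC [set c] [set b]).
by apply/setP => f; rewrite !inE; do 4!case: (f == _).
Qed.

Lemma card_nbhd_flip d G a b c e :
    adj G a b -> adj G c e -> ~~ adj G b c -> ~~ adj G a e -> a != e ->
    #|[set y | adj G a y]| = d ->
  #|[set y | adj (flip (quad a b c e) G) a y]| = d.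
Proof.
move=> ab ce nbc nae ae <-.
have anb := adj_neq ab; have cne := adj_neq ce.
have ac : a != c by apply: contra nbc => /eqP <-; rewrite adj_sym.
have be : b != e by apply: contra nae => /eqP <-.
have -> : [set y | adj (flip (quad a b c e) G) a y] =
          e |: ([set y | adj G a y] :\ b).
  apply/setP => y; rewrite !inE adj_flip in_quad eqxx (negbTE anb) (negbTE ac).
  rewrite (negbTE ae) /= ?orbF.
  have [->|ye] := eqVneq y e; first by rewrite (negbTE nae) ae orbT.
  have [->|yb] := eqVneq y b; first by rewrite ab /= andbF.
  by rewrite /= addbF; case: eqP => // <-; rewrite adj_irr.
rewrite cardsU1 !inE (negbTE nae) andbF /=.
by rewrite [RHS](cardsD1 b) inE ab.
Qed.

(** By the symmetries of [quad], each of the four corners can play the part of [a] in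
    [card_nbhd_flip], where it trades one neighbour for another. Every other vertex keeps its
    neighbours. *)
Lemma regular_flip d G a b c e :
    adj G a b -> adj G c e -> ~~ adj G b c -> ~~ adj G a e ->
    a != e -> b != c ->
  regular_graph d G -> regular_graph d (flip (quad a b c e) G).
Proof.
move=> ab ce nbc nae ae bc /forallP reg; apply/forallP => x.
have nd z : #|[set y | adj G z y]| = d by apply/eqP/reg.
have ba : adj G b a by rewrite adj_sym.
have ec : adj G e c by rewrite adj_sym.
have ncb : ~~ adj G c b by rewrite adj_sym.
have nea : ~~ adj G e a by rewrite adj_sym.
apply/eqP.
have [->|xa] := eqVneq x a; first exact: card_nbhd_flip.
have [->|xb] := eqVneq x b; first by rewrite quad_flip; exact: card_nbhd_flip.
have [->|xc] := eqVneq x c.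
  by rewrite 2!quad_rot; apply: card_nbhd_flip => //; rewrite eq_sym.
have [->|xe] := eqVneq x e.
  by rewrite 2!quad_rot quad_flip; apply: card_nbhd_flip => //; rewrite eq_sym.
rewrite -(nd x); apply: eq_card => y; rewrite !inE adj_flip in_quad.
rewrite (negbTE xa) (negbTE xb) (negbTE xc) (negbTE xe) /= addbF.
by case: eqP => // <-; rewrite adj_irr.
Qed.

End Switch.

(** * Non-backtracking walks *)

Section TupleSums.
Context (T : finType).
Implicit Types F : seq T -> nat.

Lemma sum_tuple0 F : \sum_(s : 0.-tuple T) F s = F [::].
Proof.
rewrite (bigD1 [tuple]) //= big1 ?addn0 // => s.
by move=> /eqP[]; rewrite (tuple0 s).
Qed.

Lemma sum_tupleS m F :
  \sum_(s : m.+1.-tuple T) F s = \sum_z \sum_(s : m.-tuple T) F (z :: s).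
Proof.
rewrite pair_bigA /=.
rewrite (reindex (fun p : T * m.-tuple T => [tuple of p.1 :: p.2])) //=.
exists (fun s => (thead s, [tuple of behead s])) => [[z s] _ | s _] /=.
  by congr (_, _); apply: val_inj.
by rewrite -tuple_eta.
Qed.

Lemma sum_tuple_cat i p F :
  \sum_(s : (i + p).-tuple T) F s =
  \sum_(a : i.-tuple T) \sum_(b : p.-tuple T) F (a ++ b).
Proof.
elim: i F => [|i IH] F.
  by rewrite (sum_tuple0 (fun a => \sum_(b : p.-tuple T) F (a ++ b))).
rewrite (@sum_tupleS (i + p)).
rewrite (sum_tupleS _ (fun a => \sum_(b : p.-tuple T) F (a ++ b))).
by apply: eq_bigr => z _; rewrite (IH (fun s => F (z :: s))).
Qed.

Lemma sum_tuple_rcons m F :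
  \sum_(s : m.+1.-tuple T) F s = \sum_(s : m.-tuple T) \sum_z F (rcons s z).
Proof.
rewrite -[m.+1]addn1 sum_tuple_cat; apply: eq_bigr => s _.
rewrite (@sum_tupleS 0 (fun b => F (s ++ b))); apply: eq_bigr => z _.
by rewrite (sum_tuple0 (fun b => F (s ++ z :: b))) cats1.
Qed.

Lemma sum_tuple_rev m F :
  \sum_(s : m.-tuple T) F (rev s) = \sum_(s : m.-tuple T) F s.
Proof.
rewrite [RHS](reindex_inj (h := fun s : m.-tuple T => [tuple of rev s])) //.
by move=> s t /(congr1 val) /= E; apply: val_inj; rewrite -[LHS]revK E revK.
Qed.

End TupleSums.

Section Walks.
Context (T : eqType) (e : rel T).
Implicit Types s : seq T.

Fixpoint nbw s : bool :=
  if s is x :: s1 then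
    (if s1 is y :: s2 then e x y && (if s2 is z :: _ then x != z else true)
     else true) && nbw s1
  else true.

Lemma nbw_nth x0 s : reflect
  ((forall i, i.+1 < size s -> e (nth x0 s i) (nth x0 s i.+1)) /\
   (forall i, i.+2 < size s -> nth x0 s i != nth x0 s i.+2))
  (nbw s).
Proof.
elim: s => [|x s IH]; first by apply: (iffP idP).
apply: (iffP andP) => [[h /IH[h1 h2]]|[h1 h2]].
  split=> [[|i]|[|i]] //=; try (by move=> ?; apply: h1 || apply: h2).
    by case: (s) h => [|y s2] //= /andP[].
  by case: (s) h => [|y [|z s2]] //= /andP[].
split; last by apply/IH; split=> i hi; [exact: (h1 i.+1)|exact: (h2 i.+1)].
case: s h1 h2 {IH} => [|y s2] // h1 h2; rewrite (h1 0 isT).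
by case: s2 h1 h2 => [|z s2] // h1 h2; rewrite (h2 0 isT).
Qed.

Lemma nbw_catl s t : nbw (s ++ t) -> nbw s.
Proof.
case: s => [|x0 s]// /(nbw_nth x0)[h1 h2]; apply/(nbw_nth x0).
move: (x0 :: s) h1 h2 => {}s; rewrite size_cat => h1 h2.
split=> i hi.
  by have := h1 i; rewrite !nth_cat hi (ltnW hi); apply; lia.
have hi1 : i < size s by lia.
by have := h2 i; rewrite !nth_cat hi hi1; apply; lia.
Qed.

Lemma nbw_catr s t : nbw (s ++ t) -> nbw t.
Proof. by elim: s => //= x s IH /andP[_ /IH]. Qed.

Lemma nbw_sorted s : nbw s -> sorted e s.
Proof.
by elim: s => [|x [|y s] IH] //= /andP[/andP[-> _] /IH].
Qed.

Lemma uniq_nbw s : uniq s -> sorted e s -> nbw s.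
Proof.
elim: s => [|x [|y s] IH] //=.
case/andP=> xs us /andP[-> p]; have := IH us p => /= ->; rewrite andbT.
by case: (s) xs => // z s2; rewrite !inE !negb_or => /and3P[].
Qed.

Hypothesis e_sym : symmetric e.

Lemma nbw_rev s : nbw s -> nbw (rev s).
Proof.
case: s => [|x0 s]// /(nbw_nth x0)[h1 h2]; apply/(nbw_nth x0).
move: (x0 :: s) h1 h2 => {}s; rewrite size_rev => h1 h2.
split=> i hi; rewrite !nth_rev; try lia.
  rewrite e_sym; have := h1 (size s - i.+2).
  by rewrite (_ : (size s - i.+2).+1 = size s - i.+1); [apply|]; lia.
rewrite eq_sym; have := h2 (size s - i.+3).
by rewrite (_ : (size s - i.+3).+2 = size s - i.+1); [apply|]; lia.
Qed.

End Walks.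

(** * Counting non-backtracking walks in a regular graph *)

Section WalkCounts.
Context (n d : nat) (G : sgraph n).
Hypothesis regG : regular_graph d G.

Lemma sum_adj x : \sum_y adj G x y = d.
Proof.
rewrite -(eqP (forallP regG x)) -sum1_card [LHS]big_mkcond /= [RHS]big_mkcond.
by apply: eq_bigr => y _; rewrite inE; case: adj.
Qed.

(** Each further vertex has [d - 1] choices: the neighbours of the current vertex other than its
    predecessor. *)
Lemma sum_nbw_ext m x y : adj G x y ->
  \sum_(s : m.-tuple 'I_n) nbw (adj G) (x :: y :: s) = (d - 1) ^ m.
Proof.
elim: m x y => [|m IH] x y xy.
  by rewrite (sum_tuple0 (fun s => nbw (adj G) (x :: y :: s) : nat)) /= xy.
rewrite (sum_tupleS _ (fun s => nbw (adj G) (x :: y :: s) : nat)) expnS.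
have Ed : d - 1 = \sum_(z | z != x) adj G y z.
  by rewrite -(sum_adj y) (bigD1 x) //= (adj_sym G y x) xy addKn.
rewrite [in X in X * _]Ed (bigD1 x) //=.
rewrite big1; last by move=> s _; rewrite eqxx andbF.
rewrite add0n big_distrl /=; apply: eq_bigr => z xz.
case yz: (adj G y z); last first.
  by rewrite mul0n big1 // => s _; rewrite andbF.
rewrite mul1n -(IH y z yz); apply: eq_bigr => s _.
by rewrite /= xy (eq_sym x z) xz yz.
Qed.

Lemma sum_nbw k :
  \sum_(s : k.+2.-tuple 'I_n) nbw (adj G) s = n * d * (d - 1) ^ k.
Proof.
rewrite (sum_tupleS _ (fun s => nbw (adj G) s : nat)).
transitivity (\sum_(x < n) d * (d - 1) ^ k); last first.
  by rewrite big_const_ord iter_addn_0 mulnC mulnA.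
apply: eq_bigr => x _.
rewrite (sum_tupleS _ (fun s => nbw (adj G) (x :: s) : nat)).
rewrite -[d in d * _](sum_adj x) big_distrl; apply: eq_bigr => y _.
transitivity (adj G x y * (d - 1) ^ k) => //.
case xy: (adj G x y); first by rewrite mul1n sum_nbw_ext.
by rewrite big1 // => s _; rewrite /= xy.
Qed.

(** The prescribed segment contains an edge, so it can be extended at either end with at most
    [d - 1] choices per step. The extension to the left is counted by reversing the walk. *)
Lemma sum_nbw_seg i m p (sg : seq 'I_n) : size sg = m.+2 ->
  \sum_(s : (i + (m.+2 + p)).-tuple 'I_n)
     (nbw (adj G) s && (take m.+2 (drop i s) == sg)) <= (d - 1) ^ (i + p).
Proof.
move=> szg; have symG := @adj_sym n G.
pose F s : nat := nbw (adj G) s && (take m.+2 (drop i s) == sg).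
rewrite (sum_tuple_cat _ _ F).
have [/eqP sg_nbw|/negbTE sgN] := boolP (nbw (adj G) sg == true); last first.
  rewrite big1 // => a _; rewrite (sum_tuple_cat _ _ (fun s => F (a ++ s))).
  rewrite big1 // => t _; rewrite big1 // => b _; rewrite /F.
  rewrite drop_size_cat ?size_tuple // take_size_cat ?size_tuple //.
  case: eqP => [E|]; rewrite ?andbF // andbT; case: (boolP (nbw _ _)) => //.
  by move/nbw_catr/nbw_catl; rewrite E => hh; rewrite hh in sgN.
case: sg szg sg_nbw @F => [|x [|y sg]] // szg sg_nbw F.
(* [x], [y] are the first two vertices of the segment and [v], [w] the last two; the pairs coincide
   when [sg] is empty. *)
set w := last y sg; set v := last x (belast y sg).
have Esg : x :: y :: sg = rcons (rcons (belast x (belast y sg)) v) w.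
  by rewrite /w /v -lastI /= -lastI.
have xy : adj G x y by case/andP: sg_nbw => /andP[].
have vw : adj G v w.
  move: sg_nbw; rewrite Esg -!cats1 -catA => /nbw_catr /=.
  by rewrite !andbT.
rewrite expnD -(sum_nbw_ext i (x := y) (y := x)) ?[adj G y x]symG //.
rewrite -(sum_nbw_ext p vw).
rewrite -(sum_tuple_rev _ (fun a => nbw (adj G) (y :: x :: a) : nat)).
rewrite big_distrl /=; apply: leq_sum => a _.
rewrite (sum_tuple_cat _ _ (fun s => F (a ++ s))).
rewrite exchange_big /= big_distrr /=; apply: leq_sum => b _.
have sz : size (x :: y :: sg) == m.+2 by rewrite szg.
rewrite (bigD1 (Tuple sz)) //= big1 => [|t tN]; last first.
  rewrite /F drop_size_cat ?size_tuple // take_size_cat ?size_tuple //.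
  by rewrite (negbTE (_ : tval t != x :: y :: sg)) ?andbF.
rewrite addn0 /F; case: (boolP (nbw _ _)) => //= h.
have h1 : nbw (adj G) (y :: x :: rev a).
  rewrite -[y :: x :: rev a]/(rev [:: x; y] ++ rev a) -rev_cat.
  apply: nbw_rev => //; apply: (@nbw_catl _ _ _ (sg ++ b)).
  by rewrite -catA.
have h2 : nbw (adj G) (v :: w :: b).
  move/nbw_catr: h; rewrite -!cat_cons Esg -!cats1 -!catA.
  by move/nbw_catr.
by move: h1 h2 => /= -> ->; rewrite leq_b1.
Qed.

End WalkCounts.

(** * Rooted cycles *)

Section CycleEdges.
Context (n : nat).
Implicit Types (c p : seq 'I_n) (a b : 'I_n) (e : rel 'I_n).

Lemma in_cycle_edges c a b : uniq c ->
  ([set a; b] \in cycle_edges c) =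
    (a \in c) && ((b == next c a) || (b == prev c a)).
Proof.
move=> Uc; apply/imsetP/andP => [[z zc /eqP]|[ac /orP[]/eqP->]].
- rewrite eq_set2 => /orP[]/andP[/eqP-> /eqP->]; first by rewrite eqxx.
  by rewrite mem_next prev_next // eqxx orbT.
- by exists a.
- by exists (prev c a); rewrite ?mem_prev // next_prev // setUC.
Qed.

Lemma cycle_edges_rot c i : uniq c -> cycle_edges (rot i c) = cycle_edges c.
Proof.
move=> Uc; rewrite /cycle_edges; apply/setP => f.
by apply/imsetP/imsetP => -[z zc ->]; exists z; move: zc;
  rewrite ?next_rot ?mem_rot.
Qed.

Lemma cycle_edges_rev c : uniq c -> cycle_edges (rev c) = cycle_edges c.
Proof.
move=> Uc; apply/setP => f; apply/imsetP/imsetP => -[z zc ->].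
  exists (prev c z); first by rewrite mem_prev -mem_rev.
  by rewrite next_rev // next_prev // setUC.
exists (next c z); first by rewrite mem_rev mem_next.
by rewrite next_rev // prev_next // setUC.
Qed.

Lemma prev_head a p : a \notin p -> prev (a :: p) a = last a p.
Proof.
rewrite /=; move: {4 5}a; elim: p => [|y p IH] x /=; first by rewrite eqxx.
by rewrite inE negb_or => /andP[/negbTE-> h]; apply: IH.
Qed.

(** Any edge of a cycle, in either orientation, can serve as its closing edge: rotate [a] to the
    front, after a reversal if [b] is the successor of [a]. A cycle through a switched edge thereby
    becomes a path between the ends of that edge. *)
Lemma ucycle_edge e c a b : symmetric e ->
    ucycleb e c -> [set a; b] \in cycle_edges c ->
  exists p, [/\ ucycleb e (a :: p), last a p = b, size (a :: p) = size c &
                cycle_edges (a :: p) = cycle_edges c].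
Proof.
move=> e_sym.
suff main c1 : ucycleb e c1 -> a \in c1 -> b = prev c1 a ->
    exists p, [/\ ucycleb e (a :: p), last a p = b, size (a :: p) = size c1 &
                  cycle_edges (a :: p) = cycle_edges c1].
  move=> cyc; have /andP[Cc Uc] := cyc.
  rewrite in_cycle_edges // => /andP[ac /orP[/eqP Eb|/eqP]]; last exact: main.
  have cycr : ucycleb e (rev c).
    by rewrite /ucycleb rev_uniq Uc rev_cycle -(@eq_cycle _ e) ?Cc.
  have [|||p [h1 h2 h3 h4]] := main (rev c) => //.
  - by rewrite mem_rev.
  - by rewrite prev_rev.
  by exists p; split=> //; rewrite ?h3 ?size_rev // h4 cycle_edges_rev.
move=> cyc ac1 Eb; have /andP[Cc Uc] := cyc.
case: (rot_to ac1) => i p Ep; exists p.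
rewrite -Ep /ucycleb rot_cycle rot_uniq Cc Uc cycle_edges_rot // size_rot; split=> //.
rewrite Eb -(prev_rot i Uc) Ep prev_head //.
by have : uniq (rot i c1); [rewrite rot_uniq | rewrite Ep => /andP[]].
Qed.

Lemma next_neq_prev c a : uniq c -> 2 < size c -> a \in c ->
  next c a != prev c a.
Proof.
move=> Uc sz ac; apply/eqP => E.
have E2 : next c (next c a) = a by rewrite {1}E next_prev.
case: (rot_to ac) => i p Ep.
have Ur : uniq (rot i c) by rewrite rot_uniq.
have sr : size (rot i c) = size c by rewrite size_rot.
move: E2; rewrite -!(next_rot i Uc) Ep.
move: Ur sr; rewrite Ep.
case: p {Ep} => [|y [|z p]] /=; try by move=> _; lia.
move=> /and3P[]; rewrite !inE !negb_or => /and3P[ay az _] /andP[yz _] _ _.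
rewrite eqxx; rewrite eq_sym (negbTE ay) eqxx => /eqP.
by rewrite eq_sym (negbTE az).
Qed.

(** At each vertex the edge set offers two neighbours, and the successor is the one that is not the
    predecessor. The traversal is therefore forced once its first and last vertices are known. *)
Lemma cycle_edges_inj a p p' :
    uniq (a :: p) -> uniq (a :: p') -> 1 < size p -> size p' = size p ->
    cycle_edges (a :: p) = cycle_edges (a :: p') ->
    prev (a :: p) a = prev (a :: p') a ->
  p = p'.
Proof.
set c1 := a :: p; set c2 := a :: p' => U1 U2 sz szE E Ep.
have sz1 : 2 < size c1 by [].
have sz2 : 2 < size c2 by rewrite /c2 /= szE.
have step z : z \in c1 -> prev c1 z = prev c2 z -> next c1 z = next c2 z.
  move=> zc Pz; have : [set z; next c1 z] \in cycle_edges c1.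
    by rewrite in_cycle_edges // zc eqxx.
  rewrite E in_cycle_edges // => /andP[_ /orP[/eqP//|]].
  by rewrite -Pz (negbTE (next_neq_prev _ _ _)).
have it m : [/\ iter m (next c1) a \in c1,
   iter m (next c1) a = iter m (next c2) a &
   prev c1 (iter m (next c1) a) = prev c2 (iter m (next c1) a)].
  elim: m => [|m [IH1 IH2 IH3]]; first by rewrite /= inE eqxx.
  have Es := step _ IH1 IH3; rewrite !iterS; split.
  - by rewrite mem_next.
  - by rewrite Es IH2.
  - by rewrite prev_next // Es prev_next.
have tr q : uniq (a :: q) ->
    rcons q a = traject (next (a :: q)) (next (a :: q) a) (size q).+1.
  move=> Uq; have /fpathP[m Em] := cycle_next Uq.
  rewrite Em; congr traject.
  by rewrite -(size_traject (next (a :: q)) (next (a :: q) a) m) -Em size_rcons.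
have : rcons p a = rcons p' a.
  rewrite !tr // szE; apply: (@eq_from_nth _ a); rewrite !size_traject // => i hi.
  have nthE q : nth a (traject (next (a :: q)) (next (a :: q) a) (size p).+1) i =
      iter i.+1 (next (a :: q)) a.
    rewrite (set_nth_default (next (a :: q) a)) ?size_traject //.
    by rewrite nth_traject // iterSr.
  by rewrite !nthE; have [_ -> _] := it i.+1.
by move/rcons_inj=> [].
Qed.

Lemma sum_cycle_edges c : uniq c -> 2 < size c ->
  \sum_a \sum_b ([set a; b] \in cycle_edges c) = 2 * size c.
Proof.
move=> Uc sz.
transitivity (\sum_(a in c) 2); last by rewrite sum_nat_const (card_uniqP Uc) mulnC.
rewrite [RHS]big_mkcond; apply: eq_bigr => a _.
case: ifP => ac; last by rewrite big1 // => b _; rewrite in_cycle_edges // ac.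
rewrite (bigD1 (next c a)) //= (bigD1 (prev c a)) /=; last first.
  by rewrite eq_sym next_neq_prev.
rewrite big1 => [|b /andP[b1 b2]].
  by rewrite !in_cycle_edges // ac !eqxx orbT.
by rewrite in_cycle_edges // (negbTE b1) (negbTE b2) andbF.
Qed.

(* A traversal of a cycle is determined by its first and last vertex, which may
   be the ends of any edge of the cycle in either order. *)
Lemma sum_ucycle (G : sgraph n) k : 2 < k ->
  \sum_(c : k.-tuple 'I_n) ucycleb (adj G) c = 2 * k * ncycles G k.
Proof.
case: k => // k k2.
pose A := [set c : k.+1.-tuple 'I_n | ucycleb (adj G) c].
rewrite -[LHS](@big_mkcond _ _ _ _ _
  (fun c : k.+1.-tuple 'I_n => ucycleb (adj G) c) (fun=> 1)) /=.
rewrite (eq_bigl (fun c : k.+1.-tuple 'I_n => c \in A)); last first.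
  by move=> c; rewrite /A inE.
rewrite (partition_big_imset (fun c : k.+1.-tuple 'I_n => cycle_edges c)) /=.
have -> : ncycles G k.+1 = #|[set cycle_edges (tval c) | c in A]|.
  by rewrite /ncycles; congr #|pred_of_set _|; apply/setP => f;
     apply/imsetP/imsetP => -[c h ->]; exists c => //; move: h; rewrite !inE.
rewrite mulnC -sum_nat_const; apply: eq_bigr => E /imsetP[c0].
rewrite inE => cyc0 EE; have /andP[_ U0] := cyc0.
have <- : \sum_a \sum_b ([set a; b] \in E) = 2 * k.+1.
  by rewrite EE sum_cycle_edges // size_tuple.
rewrite pair_bigA /=.
rewrite -[RHS](@big_mkcond _ _ _ _ _
  (fun ab : 'I_n * 'I_n => [set ab.1; ab.2] \in E) (fun=> 1)) /=.
rewrite !sum1dep_card.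
pose f (c : k.+1.-tuple 'I_n) := (thead c, prev c (thead c)).
rewrite -(card_in_imset (f := f)) => [|c1 c2]; last first.
  rewrite !inE => /andP[/andP[_ U1] /eqP E1] /andP[/andP[_ U2] /eqP E2] [].
  case/tupleP: c1 U1 E1 => a p U1 E1; case/tupleP: c2 U2 E2 => b p' U2 E2.
  rewrite !theadE => ab; rewrite -{}ab in U2 E2 * => Ep.
  apply: val_inj => /=; congr (_ :: _).
  apply: (@cycle_edges_inj a) => //; rewrite ?size_tuple //.
  by move: E1 E2 => /= -> ->.
apply: eq_card => -[a b]; rewrite [RHS]inE /=; apply/imsetP/idP => [[c]|].
  rewrite !inE => /andP[/andP[_ Uc] /eqP <-] [-> ->].
  rewrite in_cycle_edges // eqxx orbT andbT; case/tupleP: {Uc}c => x p.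
  by rewrite theadE inE eqxx.
rewrite EE => /(ucycle_edge (@adj_sym n G) cyc0)[p [cp lp sp Ep]].
have st : size (a :: p) == k.+1 by rewrite sp size_tuple.
exists (Tuple st); first by rewrite !inE /= cp Ep eqxx.
have Up : uniq (a :: p) by case/andP: cp.
rewrite /f /= -lp -prev_head; last by case/andP: Up.
by congr (_, _).
Qed.

End CycleEdges.

(** * Walks whose switching creates exactly one short cycle *)

Section GoodWalks.
Context (n : nat).
Implicit Types (G : sgraph n) (s p : seq 'I_n).

(* The segment s_i ... s_j lies on a cycle of length j - i + q.  Appending the
   first vertex to c covers q = 0, where the segment is the whole cycle and
   s_i = s_j. *)
Definition on_cycle (e : rel 'I_n) s i j q :=
  [exists c : (j - i + q).-tuple 'I_n, ucycleb e c &&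
     (take (j - i).+1 (drop i s) == take (j - i).+1 (c ++ take 1 c))].

(* A cycle of length at most k that is created or destroyed by switching s leaves
   s at some s_i and returns to it after at most excursion_bound k i j further steps: if it
   starts along the interior of s, its first i - 1 steps follow s.  A uniform
   threshold k - 1 would cost a factor k in the count of bad walks. *)
Definition excursion_bound k i j := if (i == 0) || (j == k.+1) then k.-1 else k - i.

Definition clash_at G k s i j q :=
  [&& i < j, q <= excursion_bound k i j, 2 < j - i + q & on_cycle (adj G) s i j q].

Definition good G k s := nbw (adj G) s &&
  ~~ [exists i : 'I_k.+2, exists j : 'I_k.+2, exists q : 'I_k,
        clash_at G k s i j q].

Lemma split_first_hit (s p : seq 'I_n) : has (mem s) p ->
  exists p0 y p1, [/\ p = p0 ++ y :: p1, y \in s &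
                      all (fun z => z \notin s) p0].
Proof.
elim: p => // z p IH /=; have [zs _|zs /IH[p0 [y [p1 [-> ys h]]]]] := boolP (z \in s).
  by exists [::], z, p.
by exists (z :: p0), y, p1; split=> //=; rewrite zs.
Qed.

(** Every edge of an excursion with nonempty interior has an end off [s]. Since a switching only
    touches pairs inside [s], such an excursion of the switched graph already exists in [G]. *)
Lemma path_off (e e' : rel 'I_n) s z p y :
    (forall a b, (a \notin s) || (b \notin s) -> e' a b -> e a b) ->
    all (fun w => w \notin s) p -> p != [::] ->
  path e' z (rcons p y) -> path e z (rcons p y).
Proof.
move=> h; elim: p z => // w p IH z /= /andP[ws als] _ /andP[zw pw].
rewrite h ?ws ?orbT //=; case: p IH als pw => [|w' p] IH als pw.
  by move: pw; rewrite /= !andbT; apply: h; rewrite ws.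
exact: IH.
Qed.

(** * The effect of a good switching on short cycles *)

Section Switching.
Context (G : sgraph n) (k : nat) (u v : 'I_n) (x : seq 'I_n).
Hypotheses (k2 : 2 < k) (szx : size x = k).
Let s := u :: rcons x v.
Let y := nth u s.
Hypothesis gd : good G k s.

Let szs : size s = k.+2. Proof. by rewrite /s /= size_rcons szx. Qed.

Let nbs : nbw (adj G) s. Proof. by case/andP: gd. Qed.

Lemma good_no_cycle i j q c : i < j -> j < k.+2 -> q <= excursion_bound k i j ->
    2 < j - i + q -> size c = j - i + q -> ucycleb (adj G) c ->
  take (j - i).+1 (drop i s) = take (j - i).+1 (c ++ take 1 c) -> False.
Proof.
move=> ij jk qb l2 szc cyc Ec; case/andP: gd => _ /negP; apply.
have ik : i < k.+2 by exact: ltn_trans jk.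
have qk : q < k by move: qb; rewrite /excursion_bound; case: ifP => [_|/negbT]; lia.
have szc' : size c == j - i + q by rewrite szc.
apply/existsP; exists (Ordinal ik); apply/existsP; exists (Ordinal jk).
apply/existsP; exists (Ordinal qk); rewrite /clash_at /= ij qb l2 /=.
by apply/existsP; exists (Tuple szc'); rewrite /= cyc Ec eqxx.
Qed.

(** A repetition [y i = y (i + m)] with the least gap [m] bounds a simple cycle. Non-backtracking
    gives [m >= 3], so this is a clash with [q = 0]. *)
Lemma good_uniq : uniq s.
Proof.
apply: contraT => /(uniqPn u)[i0 [j0 [ij0 js Eij]]].
pose P m := (0 < m) && [exists i : 'I_k.+2, (i + m < k.+2) && (y i == y (i + m))].
have exP : exists m, P m.
  rewrite szs in js; have ik : i0 < k.+2 by lia.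
  exists (j0 - i0); rewrite /P subn_gt0 ij0; apply/existsP.
  by exists (Ordinal ik); rewrite /= subnKC ?(ltnW ij0) // js /y Eij eqxx.
case: (ex_minnP exP) => m /andP[m0 /existsP[[i ik] /= /andP[imk /eqP Ey]]] minm.
have [h1 h2] := nbw_nth _ u _ nbs; rewrite szs in h1 h2.
have m1 : m != 1.
  apply/eqP => E; move: Ey imk; rewrite E addn1 /y => Ey imk.
  by have := h1 i imk; rewrite -Ey adj_irr.
have m2 : m != 2.
  apply/eqP => E; move: Ey imk; rewrite E addn2 /y => Ey imk.
  by have := h2 i imk; rewrite -Ey eqxx.
set c := take m (drop i s).
have szc : size c = m by rewrite size_takel // size_drop szs; lia.
have nc l : l < m -> nth u c l = y (i + l).
  by move=> lm; rewrite nth_take // nth_drop.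
have Uc : uniq c.
  apply: contraT => /(uniqPn u)[a [b [ab bc Eab]]]; rewrite szc in bc.
  have : P (b - a).
    rewrite /P subn_gt0 ab; apply/existsP.
    have iak : i + a < k.+2 by lia.
    exists (Ordinal iak) => /=; move: Eab; rewrite !nc //; last by lia.
    by move->; rewrite (_ : i + a + (b - a) = i + b) ?eqxx; lia.
  by move/minm; lia.
have Et : take m.+1 (drop i s) = rcons c (y i).
  by rewrite (take_nth u) ?nth_drop ?size_drop ?szs -?/y ?Ey //; lia.
have Ec : c = y i :: behead c.
  by case: (c) szc nc => [|z c'] /= zc nc; [lia | rewrite -(addn0 i) -nc].
have so : sorted (adj G) (rcons c (y i)).
  by rewrite -Et; apply/take_sorted/drop_sorted/nbw_sorted.
have cy : ucycleb (adj G) c.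
  by rewrite /ucycleb Uc andbT; move: so; rewrite Ec.
exfalso; apply: (@good_no_cycle i (i + m) 0 c) => //; rewrite ?addKn ?addn0 //; try lia.
have -> : take 1 c = [:: y i] by rewrite {1}Ec /= take0.
by rewrite Et cats1 take_oversize // size_rcons szc.
Qed.

Let y_inj i j : i < k.+2 -> j < k.+2 -> y i = y j -> i = j.
Proof.
by move=> ik jk /eqP; rewrite nth_uniq ?szs ?good_uniq // => /eqP.
Qed.

(** The segment from [y i] to [y j], closed up by the excursion [p], is a cycle of length
    [j - i + size p + 1]. Goodness forbids it unless the excursion exceeds its bound. *)
Lemma excursion_lt i j p : i < j -> j < k.+2 -> uniq p ->
    all (fun z => z \notin s) p -> path (adj G) (y j) (rcons p (y i)) ->
  2 < j - i + (size p).+1 -> excursion_bound k i j < (size p).+1.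
Proof.
move=> ij jk Up offp pa l2; rewrite ltnNge; apply/negP => qb.
pose t := take (j - i) (drop i.+1 s).
have Et : take (j - i).+1 (drop i s) = y i :: t.
  by rewrite (drop_nth u) ?szs; last lia.
have szt : size t = j - i by rewrite size_takel // size_drop szs; lia.
have lt : last (y i) t = y j.
  rewrite -nth_last -[nth _ t _]/(nth (y i) (y i :: t) (size t).-1.+1).
  rewrite prednK ?szt ?subn_gt0 // -Et nth_take // nth_drop subnKC ?(ltnW ij) //.
  by apply: set_nth_default; rewrite szs.
apply: (@good_no_cycle i j (size p).+1 ((y i :: t) ++ p)) => //.
- by rewrite size_cat /= szt; lia.
- apply/andP; split.
    rewrite /= rcons_cat cat_path lt pa andbT.
    have : sorted (adj G) (y i :: t).
      by rewrite -Et; apply/take_sorted/drop_sorted/nbw_sorted.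
    by [].
  rewrite cat_uniq Up andbT -Et take_uniq ?drop_uniq ?good_uniq //=.
  apply/hasPn => z zp; move/allP: offp => /(_ z zp).
  by apply: contra => /mem_take /mem_drop.
by rewrite Et -catA take_size_cat //= szt.
Qed.

(** The two orientations of an excursion reduce to [excursion_lt] by reversal. The last premise
    excludes an edge of the walk itself, which would close up with its own segment to a degenerate
    cycle of length 2. *)
Lemma excursion a b p : a < k.+2 -> b < k.+2 -> a != b -> uniq p ->
    all (fun z => z \notin s) p -> path (adj G) (y a) (rcons p (y b)) ->
    (p = [::] -> (b != a.+1) && (a != b.+1)) ->
  excursion_bound k (minn a b) (maxn a b) < (size p).+1.
Proof.
move=> ak bk ab Up offp pa h.
have h' : 0 < size p \/ (b != a.+1) && (a != b.+1).
  by case: (p) h => [|? ?] h; [right; apply: h|left].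
case: (ltngtP a b) ab => // lab _; last first.
  by apply: excursion_lt => //; case: h' => [|/andP[]]; lia.
rewrite -(size_rev p); apply: excursion_lt => //.
- by rewrite rev_uniq.
- by rewrite all_rev.
- have := rev_path (adj G) (y a) (rcons p (y b)).
  rewrite last_rcons belast_rcons rev_cons => ->.
  by rewrite -(@eq_path _ (adj G)) // => z w; rewrite adj_sym.
by rewrite size_rev; case: h' => [|/andP[]]; lia.
Qed.

Let b := y 1.
Let c := y k.
Let G' := flip (quad u b c v) G.

Let y0 : y 0 = u. Proof. by []. Qed.

Let yS i : i < k -> y i.+1 = nth u x i.
Proof. by move=> ik; rewrite /y /= nth_rcons szx ik. Qed.

Let yk : y k.+1 = v.
Proof. by rewrite /y /= nth_rcons szx ltnn eqxx. Qed.

Let y_in i : i < k.+2 -> y i \in s.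
Proof. by move=> ik; rewrite mem_nth ?szs. Qed.

Let y_ex z : z \in s -> exists2 i, i < k.+2 & z = y i.
Proof.
by move=> zs; exists (index z s); rewrite -?szs ?index_mem // /y nth_index.
Qed.

Let y_neq i j : i < k.+2 -> j < k.+2 -> i != j -> y i != y j.
Proof. by move=> ik jk; apply: contra => /eqP /y_inj ->. Qed.

Let ub : adj G u b.
Proof. by have [h _] := nbw_nth _ u _ nbs; have := h 0; rewrite szs; apply. Qed.

Let cv : adj G c v.
Proof. by have [h _] := nbw_nth _ u _ nbs; have := h k; rewrite szs -/y yk; apply. Qed.

Lemma good_not_adj_inner : ~~ adj G b c.
Proof.
apply/negP => bc; have := @excursion 1 k [::]; rewrite /= bc.
by rewrite /excursion_bound; case: ifP => _; lia.
Qed.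

Lemma good_not_adj_outer : ~~ adj G u v.
Proof.
apply/negP => uv; have := @excursion 0 k.+1 [::]; rewrite /= yk uv.
by rewrite /excursion_bound min0n eqxx /=; lia.
Qed.

Let u_b : u != b. Proof. by rewrite -y0 y_neq //; lia. Qed.
Let u_c : u != c. Proof. by rewrite -y0 y_neq //; lia. Qed.
Let u_v : u != v. Proof. by rewrite -y0 -yk y_neq //; lia. Qed.
Let b_c : b != c. Proof. by rewrite y_neq //; lia. Qed.

Lemma good_regular d : regular_graph d G -> regular_graph d G'.
Proof. by apply: regular_flip => //; [exact: good_not_adj_inner|exact: good_not_adj_outer]. Qed.

Let adjE z w : adj G' z w =
  (z != w) && (adj G z w (+) ([set z; w] \in quad u b c v)).
Proof. exact: adj_flip. Qed.

Let adj'_off z w : (z \notin s) || (w \notin s) -> adj G' z w -> adj G z w.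
Proof.
move=> off; rewrite adjE in_quad => /andP[_].
have nu : u \in s by rewrite -y0 y_in.
have nb : b \in s by rewrite y_in.
have nc : c \in s by rewrite y_in.
have nv : v \in s by rewrite -yk y_in.
have ne t r : t \notin s -> r \in s -> (t == r) = false.
  by move=> ts rs; apply: contraNF ts => /eqP ->.
by case/orP: off => off; rewrite !(ne _ _ off) // ?andbF /= addbF.
Qed.

Let adj'_adj z w : adj G' z w ->
  [\/ adj G z w, [set z; w] = [set b; c] | [set z; w] = [set u; v]].
Proof.
rewrite adjE !inE => /andP[_].
have [_ _|nzw /=] := boolP (adj G z w); first exact: Or31.
case/orP=> [/orP[/orP[]|]|] /eqP E.
- by move: nzw; rewrite /adj E -/(adj G u b) ub.
- exact: Or32.
- by move: nzw; rewrite /adj E -/(adj G c v) cv.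
- by apply: Or33; rewrite E setUC.
Qed.

Let adj_adj' z w : adj G z w ->
  [\/ adj G' z w, [set z; w] = [set u; b] | [set z; w] = [set v; c]].
Proof.
move=> zw; rewrite adjE !inE (adj_neq zw) zw /=.
case: (boolP (_ || _)) => h; last exact: Or31.
case/orP: h => [/orP[/orP[]|]|] /eqP E.
- exact: Or32.
- by move: zw; rewrite /adj E -/(adj G b c) (negbTE good_not_adj_inner).
- by apply: Or33; rewrite E setUC.
- by move: zw; rewrite /adj E setUC -/(adj G u v) (negbTE good_not_adj_outer).
Qed.

Let adj'_ub : adj G' u b = false.
Proof. by rewrite adjE ub in_quad !eqxx /= andbF. Qed.

Lemma adj_flip_bc : adj G' b c.
Proof. by rewrite adjE b_c (negbTE good_not_adj_inner) in_quad !eqxx ?orbT. Qed.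

Lemma adj_flip_uv : adj G' u v.
Proof. by rewrite adjE u_v (negbTE good_not_adj_outer) in_quad !eqxx ?orbT. Qed.

(** At the ends [u] and [v] of the walk the excursion bound is [k - 1], so an excursion leaving from
    there needs at least [k] steps to return. The relation [e] is [adj G] when a destroyed cycle is
    examined and [adj G'] when a created one is. The last premise keeps the first step from
    following the walk. *)
Lemma no_escape (e : rel 'I_n) z w p : (z, w) = (u, b) \/ (z, w) = (v, c) ->
    (forall a1 a2, (a1 \notin s) || (a2 \notin s) -> e a1 a2 -> adj G a1 a2) ->
    uniq (z :: p) -> path e z p -> has (mem s) p -> size p < k ->
    (head z p \in s -> adj G z (head z p) && (head z p != w)) -> False.
Proof.
move=> zw he Up pa hs szp hd.
have [a ak [Ez ha]] : exists2 a, a < k.+2 & z = y a /\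
    forall t, t < k.+2 -> y t != w ->
      ((a == 0) && (t != 1)) || ((a == k.+1) && (t != k)).
  case: zw => -[-> ->].
    by exists 0 => //; split=> // t tk h; rewrite /= orbF; apply: contra h => /eqP->.
  exists k.+1 => //; split=> // t tk h; apply/orP; right; rewrite eqxx.
  by apply: contra h => /eqP->.
have [p0 [w0 [p1 [Ep w0s off]]]] := split_first_hit hs.
have [t tk Ew] := y_ex w0s.
move: Up pa hd szp; rewrite {}Ep {}Ew => Up pa hd szp.
have ta : a != t.
  apply/eqP => E; move: Up; rewrite Ez E /= mem_cat inE eqxx.
  by rewrite orbT.
have Up0 : uniq p0 by move: Up => /= /andP[_]; rewrite cat_uniq => /andP[].
have pa0 : path e z (rcons p0 (y t)).
  by move: pa; rewrite -cat_rcons cat_path => /andP[].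
have pa1 : path (adj G) (y a) (rcons p0 (y t)).
  case: (altP (p0 =P [::])) => [E|pN]; last first.
    by rewrite -Ez; exact: (path_off he off pN pa0).
  by move: hd; rewrite E /= Ez y_in // => /(_ isT)/andP[->].
have hnil : p0 = [::] -> (t != a.+1) && (a != t.+1).
  move=> E; move: hd; rewrite E /= y_in // => /(_ isT)/andP[_ /(ha _ tk)].
  by case/orP=> /andP[/eqP-> tt]; move: tk tt; clear; lia.
have := excursion ak tk ta Up0 off pa1 hnil.
have a0 : (a == 0) || (a == k.+1).
  case: zw => -[E _]; move: Ez; rewrite E.
    by rewrite -y0 => /y_inj <- //.
  by rewrite -yk => /y_inj <- //; rewrite eqxx orbT.
rewrite /excursion_bound ifT; first by move: szp; rewrite size_cat /=; clear; lia.
by case/orP: a0 => /eqP ->; move: tk; clear; lia.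
Qed.

Let last_neq (z w : 'I_n) p : uniq (z :: p) -> last z p = w -> 1 < size p ->
  head z p != w.
Proof.
case: p => [|h [|h' p]] //= /and3P[_ hp _] <- _.
by apply: contra hp => /eqP ->; apply: mem_last.
Qed.

(** The only edges lost are [u b] and [c v]. A short cycle through one of them, traversed from [u]
    or [v] so that the lost edge closes it, is excluded by [no_escape]. *)
Lemma good_ucycle_flip q : ucycleb (adj G) q -> 2 < size q <= k ->
  ucycleb (adj G') q.
Proof.
move=> cyc /andP[sq2 sqk]; have /andP[Cq Uq] := cyc.
rewrite /ucycleb Uq andbT; apply: cycle_from_next => // z zq.
have zedge : [set z; next q z] \in cycle_edges q.
  by rewrite in_cycle_edges // zq eqxx.
have main w0 w1 : (w0, w1) = (u, b) \/ (w0, w1) = (v, c) ->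
    [set w0; w1] \in cycle_edges q -> False.
  move=> hw /(ucycle_edge (@adj_sym n G) cyc)[p [/andP[Cp Up] lp sp _]].
  have sp1 : 1 < size p by move: sp sq2 => /=; clear; lia.
  have w1s : w1 \in s by case: hw => -[_ ->]; apply: y_in.
  have pp : path (adj G) w0 p.
    by move: Cp; rewrite /= rcons_path => /andP[].
  apply: (no_escape hw (fun _ _ _ h => h) Up pp).
  - apply/hasP; exists w1 => //; rewrite -lp; case: (p) sp1 => //= ? ? _.
    exact: mem_last.
  - by move: sp sqk => /=; clear; lia.
  rewrite (last_neq Up lp sp1) andbT => _.
  by case: (p) sp1 pp => //= ? ? _ /andP[].
case: (adj_adj' (next_cycle Cq zq)) => // E; exfalso; rewrite E in zedge.
  by apply: main zedge; left.
by apply: main zedge; right.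
Qed.

(** The cycle follows the walk vertex by vertex. A first departure after [m] steps, at [y m.+1],
    would be an excursion that has to be back on [s] within [k - 1 - m] steps, because [c] lies on
    [s]. This is within the bound [k - m.+1] at that vertex, and within the larger bounds for the
    other possible endpoints. *)
Lemma follow_walk p : ucycleb (adj G') (b :: p) -> last b p = c ->
  1 < size p < k -> b :: p = x.
Proof.
move=> /andP[Cp Up] lp /andP[sp1 spk].
have pp : path (adj G') b p by move: Cp; rewrite /= rcons_path => /andP[].
have inj i j : i <= size p -> j <= size p ->
    nth u (b :: p) i = nth u (b :: p) j -> i = j.
  by move=> hi hj /eqP; rewrite nth_uniq // => /eqP.
have nlast : nth u (b :: p) (size p) = c.
  by rewrite -lp (last_nth u).
have claim m : m <= size p -> nth u (b :: p) m = y m.+1.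
  elim/ltn_ind: m => -[//|m] IH mp.
  apply/eqP; apply: contraT => /eqP nE; exfalso.
  have Em : nth u (b :: p) m = y m.+1 by exact: IH (ltnSn m) (ltnW mp).
  set p' := drop m p.
  have Ed : drop m (b :: p) = y m.+1 :: p'.
    by rewrite (drop_nth u) ?Em //= ltnS ltnW.
  have Up' : uniq (y m.+1 :: p') by rewrite -Ed drop_uniq.
  have pp' : path (adj G') (y m.+1) p'.
    have : sorted (adj G') (drop m (b :: p)) by apply/drop_sorted.
    by rewrite Ed.
  have np' i : nth u p' i = nth u (b :: p) (m.+1 + i) by rewrite nth_drop.
  have szp' : size p' = size p - m by rewrite size_drop.
  have hs : has (mem s) p'.
    apply/hasP; exists c; last by apply: y_in.
    rewrite -nlast -(subnKC mp) -np' mem_nth // szp'.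
    by move: mp; clear; lia.
  have [p0 [w0 [p1 [Ep w0s off]]]] := split_first_hit hs.
  have [t tk Ew] := y_ex w0s; rewrite {}Ew {w0s} in Ep.
  have Up0 : uniq p0.
    by move: Up'; rewrite Ep /= => /andP[_]; rewrite cat_uniq => /andP[].
  have mt : m.+1 != t.
    by apply/eqP => E; move: Up'; rewrite Ep E /= mem_cat inE eqxx orbT.
  have hm : m.+1 < k.+2 by move: mp spk; clear; lia.
  have pa0 : path (adj G') (y m.+1) (rcons p0 (y t)).
    by move: pp'; rewrite Ep -cat_rcons cat_path => /andP[].
  have Et : p0 = [::] -> nth u (b :: p) m.+1 = y t.
    by move=> E; rewrite -[m.+1]addn0 -np' Ep E.
  have hadj : p0 = [::] -> adj G (y m.+1) (y t).
    move=> E; move: pa0; rewrite E /= andbT => a'.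
    case: (adj'_adj a') => // /eqP.
      rewrite eq_set2 => /orP[]/andP[/eqP e1 /eqP e2]; exfalso.
        have m0 : m.+1 = 1 by exact: (y_inj hm _ e1).
        have : m.+1 = size p by apply: inj => //; rewrite Et // e2 nlast.
        by rewrite m0 => sp; move: sp1; rewrite -sp.
      have : m.+1 = 0 by apply: inj => //; rewrite Et // e2.
      by [].
    rewrite eq_set2 => /orP[]/andP[/eqP e1 _]; exfalso.
      by have := y_inj hm (ltn0Sn _) e1.
    have := y_inj hm (ltnSn _) (etrans e1 (esym yk)).
    by move: mp spk; clear; lia.
  have hnil : p0 = [::] -> (t != m.+2) && (m.+1 != t.+1).
    move=> E; apply/andP; split; apply/eqP => E'.
      by apply: nE; rewrite Et // E'.
    have Em' : t = m by case: E'.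
    move: pa0; rewrite E /= andbT => a'.
    have [m0|m0] := posnP m.
      by move: a'; rewrite Em' m0 adj_sym adj'_ub.
    have m1 : m.-1 < m.+1 by clear; lia.
    have m1p : m.-1 <= size p by move: mp; clear; lia.
    have : m.+1 = m.-1 by apply: inj => //; rewrite Et // Em' IH // prednK.
    by clear; lia.
  have pa1 : path (adj G) (y m.+1) (rcons p0 (y t)).
    case: (altP (p0 =P [::])) => [E|pN].
      by rewrite E /= hadj.
    exact: (path_off adj'_off off pN pa0).
  have := excursion hm tk mt Up0 off pa1 hnil.
  have : size p0 < size p' by rewrite Ep size_cat /= addnS ltnS leq_addr.
  rewrite szp'; move: mp spk tk; clear; rewrite /excursion_bound.
  by case: ifP => [_|/negbT]; lia.
have szp : (size p).+1 = k.
  by apply: y_inj => //; [move: spk; clear; lia | rewrite -claim // nlast].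
apply: (@eq_from_nth _ u); first by rewrite /= szx szp.
by move=> i /= hi; rewrite claim // yS // -szp.
Qed.

(** A created cycle uses an inserted edge. Through [b c] it is [x], by [follow_walk]; through [u v]
    but not [b c], it is a path from [u] back to [v] excluded by [no_escape]. *)
Lemma good_ucycle_flip_inv q : ucycleb (adj G') q -> 2 < size q <= k ->
  ucycleb (adj G) q \/ size q = k /\ cycle_edges q = cycle_edges x.
Proof.
move=> cyc /andP[sq2 sqk]; have /andP[Cq Uq] := cyc.
have symG' := @adj_sym n G'.
have [bc|nbc] := boolP ([set b; c] \in cycle_edges q).
  right; have [p [cp lp sp Ep]] := ucycle_edge symG' cyc bc.
  have Ex : b :: p = x.
    by apply: follow_walk => //; move: sp sq2 sqk => /=; clear; lia.
  by rewrite -Ep -sp Ex szx.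
left; rewrite /ucycleb Uq andbT; apply: cycle_from_next => // z zq.
have zedge : [set z; next q z] \in cycle_edges q.
  by rewrite in_cycle_edges // zq eqxx.
case: (adj'_adj (next_cycle Cq zq)) => // E; rewrite E in zedge.
  by rewrite zedge in nbc.
exfalso; have [p [/andP[Cp Up] lp sp _]] := ucycle_edge symG' cyc zedge.
have sp1 : 1 < size p by move: sp sq2 => /=; clear; lia.
have pp : path (adj G') u p by move: Cp; rewrite /= rcons_path => /andP[].
apply: (@no_escape (adj G') u b p) => //; first by left.
- apply/hasP; exists v; last by rewrite /= -yk; apply: y_in.
  by rewrite -lp; case: (p) sp1 => //= ? ? _; apply: mem_last.
- by move: sp sqk => /=; clear; lia.
have hv := last_neq Up lp sp1.
have a' : adj G' u (head u p) by case: (p) sp1 pp => //= ? ? _ /andP[].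
move=> _; apply/andP; split; last first.
  by apply: contraTN a' => /eqP ->; rewrite adj'_ub.
case: (adj'_adj a') => // /eqP; rewrite eq_set2.
  by rewrite (negbTE u_b) (negbTE u_c).
by rewrite (negbTE hv) (negbTE u_v) andbF.
Qed.

Let k_gt0 : 0 < k. Proof. exact: ltn_trans k2. Qed.

Let x_cons : x = b :: behead x.
Proof. by rewrite /b yS //; move: k_gt0; case: (x) szx => [<-|]. Qed.

Let last_x : last b (behead x) = c.
Proof.
have := last_nth u b (behead x); rewrite -x_cons size_behead szx => ->.
by rewrite /c -[in RHS](prednK k_gt0) yS // ltn_predL.
Qed.

Lemma good_ucycle_x : ucycleb (adj G') x.
Proof.
have Ux : uniq x.
  by move: good_uniq; rewrite /s /= rcons_uniq => /and3P[].
have so : sorted (adj G') x.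
  apply/(sortedP u) => i; rewrite szx => ik.
  have A1 : i.+1 < k.+2 by move: ik; clear; lia.
  have A2 : i.+2 < k.+2 by move: ik; clear; lia.
  have A3 : i.+1 != k.+1 by move: ik; clear; lia.
  have A4 : i.+2 != k.+1 by move: ik; clear; lia.
  have [h _] := nbw_nth _ u _ nbs; have := h i.+1; rewrite szs => /(_ A2).
  rewrite -!/(y _) => a; rewrite -!yS ?(ltnW ik) //.
  case: (adj_adj' a) => // /eqP; rewrite eq_set2 => /orP[]/andP[/eqP e1 /eqP e2].
  - by have := y_inj A1 (ltn0Sn _) e1.
  - by have := y_inj A2 (ltn0Sn _) e2.
  - by move: (y_neq A1 (ltnSn _) A3); rewrite e1 yk eqxx.
  - by move: (y_neq A2 (ltnSn _) A4); rewrite e2 yk eqxx.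
rewrite /ucycleb Ux andbT x_cons /= rcons_path last_x.
by move: so; rewrite x_cons /= => ->; rewrite adj_sym adj_flip_bc.
Qed.

Lemma inner_edge_in_cycle : [set b; c] \in cycle_edges x.
Proof.
have Ux : uniq x by case/andP: good_ucycle_x.
rewrite in_cycle_edges // x_cons mem_head -last_x prev_head ?eqxx ?orbT //.
by move: Ux; rewrite x_cons /= => /andP[].
Qed.

Lemma good_ncycles_lt j : 2 < j < k -> ncycles G' j = ncycles G j.
Proof.
case/andP=> j2 jk; rewrite /ncycles; congr #|pred_of_set _|.
apply/setP => f; apply/imsetP/imsetP => -[q]; rewrite inE => cq ->.
  exists q => //; rewrite inE.
  case: (good_ucycle_flip_inv cq) => [||[+ _]] //.
    by rewrite size_tuple j2 ltnW.
  by rewrite size_tuple => E; exfalso; move: jk; rewrite E ltnn.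
by exists q => //; rewrite inE good_ucycle_flip // size_tuple j2 ltnW.
Qed.

Lemma good_ncycles : ncycles G' k = (ncycles G k).+1.
Proof.
rewrite /ncycles; set A := imset _ _; set B := imset _ _.
suff -> : A = cycle_edges x |: B.
  rewrite cardsU1 (_ : _ \notin _) //; apply/imsetP => -[q].
  rewrite inE => /andP[Cq Uq] E; have := inner_edge_in_cycle; rewrite E in_cycle_edges //.
  case/andP=> bq /orP[]/eqP Ec; move: good_not_adj_inner.
    by rewrite Ec (next_cycle Cq).
  by rewrite adj_sym Ec (prev_cycle Cq).
apply/setP => f; rewrite in_setU1; apply/imsetP/idP => [[q]|].
  rewrite inE => cq ->; case: (good_ucycle_flip_inv cq).
  - by rewrite size_tuple k2 leqnn.
  - move=> h; apply/orP; right; apply/imsetP; exists q => //.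
    by rewrite inE.
  - by case=> _ ->; rewrite eqxx.
case/orP=> [/eqP->|/imsetP[q]].
  have sx : size x == k by rewrite szx.
  by exists (Tuple sx); rewrite ?inE /= ?good_ucycle_x.
rewrite inE => cq ->; exists q => //.
by rewrite inE good_ucycle_flip // size_tuple k2 leqnn.
Qed.

End Switching.
End GoodWalks.

(** * Expected numbers of cycles and of bad walks *)

Section Counting.
Context (n d : nat).
Implicit Types (G : sgraph n).

Definition walk_quad (u : 'I_n) (x : seq 'I_n) (v : 'I_n) :=
  quad u (nth u (u :: rcons x v) 1) (nth u (u :: rcons x v) (size x)) v.

Lemma walk_quadE u b (x : seq 'I_n) v :
  walk_quad u (b :: x) v = quad u b (last b x) v.
Proof.
rewrite /walk_quad /=; congr quad.
by rewrite -rcons_cons nth_rcons /= ltnSn nth_last.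
Qed.

Lemma sum_flip_le Q (P P' : pred (sgraph n)) :
  (forall G, P G -> P' (flip Q G)) -> \sum_G P G <= \sum_G P' G.
Proof.
move=> h; rewrite [leqRHS](reindex_inj (inv_inj (flipK Q))) /=.
by apply: leq_sum => G _; case: (boolP (P G)) => // /h ->.
Qed.

(* The edges u v that can be switched with the closing edge of the cycle c. *)
Definition suitable G (u : 'I_n) (c : seq 'I_n) (v : 'I_n) :=
  [&& adj G u v, u \notin c, v \notin c, ~~ adj G u (head u c)
    & ~~ adj G v (last u c)].

(** Of the [n d] ordered edges, at most [d * size c] have their first end on the cycle and as many
    their second; at most [d ^ 2] start at a neighbour of the head and as many end at a neighbour of
    the last vertex. *)
Lemma sum_suitable G c : regular_graph d G -> uniq c -> 0 < size c ->
  n * d <= \sum_u \sum_v suitable G u c v + 2 * (d * (size c + d)).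
Proof.
move=> regG Uc c0.
case: c c0 Uc => // b c _ Uc; set t := last b c.
have E1 : \sum_(u < n) \sum_v adj G u v = n * d.
  rewrite (eq_bigr (fun=> d)) => [|u _]; last exact: sum_adj.
  by rewrite big_const_ord iter_addn_0 mulnC.
have Ein (A : pred 'I_n) : \sum_u \sum_v (adj G u v && A u) = d * \sum_u A u.
  rewrite big_distrr /=; apply: eq_bigr => u _.
  rewrite -[d in d * _](sum_adj regG u) big_distrl /=; apply: eq_bigr => v _.
  by case: adj; case: (A u).
have Ein' (A : pred 'I_n) : \sum_u \sum_v (adj G u v && A v) = d * \sum_u A u.
  rewrite exchange_big /= -Ein; apply: eq_bigr => u _; apply: eq_bigr => v _.
  by rewrite adj_sym.
have Ec : \sum_u (u \in b :: c) = (size c).+1.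
  rewrite -[RHS]/(size (b :: c)) -(card_uniqP Uc) -sum1_card [RHS]big_mkcond /=.
  by apply: eq_bigr => u _; case: (u \in _).
have Eb w : \sum_u adj G u w = d.
  by rewrite -(sum_adj regG w); apply: eq_bigr => u _; rewrite adj_sym.
rewrite -E1.
have /leq_trans -> // : \sum_(u < n) \sum_v adj G u v <=
  \sum_u \sum_v suitable G u (b :: c) v +
  (\sum_u \sum_v (adj G u v && (u \in b :: c)) +
   \sum_u \sum_v (adj G u v && (v \in b :: c)) +
   (\sum_u \sum_v (adj G u v && adj G u b) +
    \sum_u \sum_v (adj G u v && adj G v t))).
  rewrite -!big_split /=; apply: leq_sum => u _.
  rewrite -!big_split /=; apply: leq_sum => v _.
  rewrite /suitable -[head _ _]/b -[last _ _]/t.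
  by move: (adj G u v) (u \in b :: c) (v \in b :: c) (adj G u b) (adj G v t)
    => [] [] [] [] [].
rewrite (Ein (fun u => u \in b :: c)) (Ein' (fun u => u \in b :: c)).
by rewrite (Ein (fun u => adj G u b)) (Ein' (fun u => adj G u t)) Ec !Eb /=; lia.
Qed.

(** The reverse switching removes [u v] and the closing edge of the cycle and joins [u] and [v] to
    the ends of the path that remains, which opens the cycle into a walk from [u] to [v]. *)
Lemma suitable_switch G u (x : seq 'I_n) v : 2 < size x ->
    regular_graph d G -> ucycleb (adj G) x -> suitable G u x v ->
  regular_graph d (flip (walk_quad u x v) G) &&
  nbw (adj (flip (walk_quad u x v) G)) (u :: rcons x v).
Proof.
case: x => // b x sz regG /andP[Cx Ux] /and5P[uv ux vx nub nvt].
rewrite /= in nub nvt; rewrite walk_quadE; set t := last b x in nvt *.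
have bt : adj G b t.
  by move: Cx; rewrite /= rcons_path adj_sym => /andP[].
have bx : b \in b :: x by rewrite mem_head.
have tx : t \in b :: x by rewrite mem_last.
have ne (z w : 'I_n) : z \in b :: x -> w \notin b :: x -> (z == w) = false.
  by move=> zx; apply: contraNF => /eqP <-.
have bu := ne _ _ bx ux; have tv := ne _ _ tx vx.
have uv' := adj_neq uv.
apply/andP; split.
  rewrite quad_rot; apply: regular_flip => //.
  - by rewrite adj_sym.
  - by rewrite adj_sym.
  - by rewrite adj_sym.
  - by rewrite bu.
  - by rewrite tv.
apply: uniq_nbw.
  by rewrite cons_uniq mem_rcons in_cons negb_or uv' ux rcons_uniq vx Ux.
have sx : sorted (adj (flip (quad u b t v) G)) (b :: x).
  apply/(sortedP u) => i hi.
  have hi' : i < size (b :: x) by exact: ltnW.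
  have m1 : nth u (b :: x) i \in b :: x by rewrite mem_nth.
  have m2 : nth u (b :: x) i.+1 \in b :: x by rewrite mem_nth.
  have a1 : adj G (nth u (b :: x) i) (nth u (b :: x) i.+1).
    have : sorted (adj G) (b :: x) by move: Cx; rewrite /= rcons_path => /andP[].
    by move/(sortedP u)/(_ i hi).
  rewrite adj_flip a1 (adj_neq a1) in_quad.
  rewrite (ne _ _ m1 ux) (ne _ _ m1 vx) (ne _ _ m2 ux) (ne _ _ m2 vx) /= !andbF /= !orbF.
  have nE j l : j < size (b :: x) -> l < size (b :: x) ->
      nth u (b :: x) j = nth u (b :: x) l -> j = l.
    by move=> hj hl /eqP; rewrite nth_uniq // => /eqP.
  apply/negP => /orP[]/andP[/eqP e1 /eqP e2].
    have i0 : i = 0 by apply: nE.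
    have : i.+1 = size x by apply: nE => //; rewrite -(last_nth u).
    by move: sz => /=; rewrite i0 => + E; rewrite -E.
  by have := @nE i.+1 0 hi isT e2.
rewrite /= rcons_path; move: sx => /= ->.
rewrite !adj_flip !in_quad -/t !eqxx tv (eq_sym u b) bu ?orbT /=.
by rewrite (negbTE nub) [adj G t v]adj_sym (negbTE nvt).
Qed.

Lemma sum_walk k (F : seq 'I_n -> nat) :
  \sum_u \sum_(x : k.-tuple 'I_n) \sum_v F (u :: rcons x v) =
  \sum_(s : k.+2.-tuple 'I_n) F s.
Proof.
rewrite sum_tupleS; apply: eq_bigr => u _.
by rewrite (sum_tuple_rcons _ (fun s => F (u :: s))).
Qed.

Definition nreg := \sum_(G : sgraph n) regular_graph d G.

Definition nrooted l G := \sum_(c : l.-tuple 'I_n) ucycleb (adj G) c.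

(** For fixed [u], [c], [v] the reverse switching is injective on graphs and lands among those in
    which [u c v] is a non-backtracking walk; the number of such walks in a regular graph is known
    exactly. *)
Lemma sum_nrooted_le l : 2 < l ->
  \sum_(G | regular_graph d G) nrooted l G * (n * d - 2 * (d * (l + d)))
    <= nreg * (n * d * (d - 1) ^ l).
Proof.
move=> l2.
have step1 : \sum_(G | regular_graph d G) nrooted l G * (n * d - 2 * (d * (l + d)))
   <= \sum_u \sum_(c : l.-tuple 'I_n) \sum_v \sum_G
        [&& regular_graph d G, ucycleb (adj G) c & suitable G u c v].
  rewrite [leqLHS]big_mkcond /=.
  under [leqRHS]eq_bigr do (under eq_bigr do rewrite exchange_big /=).
  under [leqRHS]eq_bigr do rewrite exchange_big /=.
  rewrite exchange_big /=; apply: leq_sum => G _.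
  rewrite exchange_big /=.
  case: ifP => // regG; rewrite /nrooted big_distrl /=; apply: leq_sum => c _.
  case: (boolP (ucycleb _ _)) => // cyc; rewrite mul1n.
  have /= := @sum_suitable G c regG; rewrite size_tuple => h.
  rewrite leq_subLR addnC; apply: h; last by lia.
  by case/andP: cyc.
apply: leq_trans step1 _.
apply: (@leq_trans (\sum_u \sum_(c : l.-tuple 'I_n) \sum_v \sum_G
    (regular_graph d G && nbw (adj G) (u :: rcons c v)))).
  apply: leq_sum => u _; apply: leq_sum => c _; apply: leq_sum => v _.
  apply: (@sum_flip_le (walk_quad u c v)) => G /and3P[regG cyc su].
  by apply: suitable_switch => //; rewrite size_tuple.
under eq_bigr do (under eq_bigr do rewrite exchange_big /=).
under eq_bigr do rewrite exchange_big /=.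
rewrite exchange_big /= /nreg big_distrl /=; apply: leq_sum => G _.
case: (boolP (regular_graph d G)) => regG; last first.
  by rewrite big1 // => u _; rewrite big1 // => x _; rewrite big1.
rewrite mul1n -(sum_nbw regG).
by rewrite -(sum_walk _ (fun s => nbw (adj G) s : nat)).
Qed.

Lemma sum_nrooted_le2 l : 2 < l -> 0 < n -> 0 < d -> 4 * (l + d) <= n ->
  \sum_(G | regular_graph d G) nrooted l G <= 2 * (nreg * (d - 1) ^ l).
Proof.
move=> l2 n0 d0 nl; have := sum_nrooted_le l2; rewrite -big_distrl /=.
set S := \sum_(_ | _) _; set T := _ ^ l => h.
have nd0 : 0 < n * d by rewrite muln_gt0 n0.
rewrite -(leq_pmul2r nd0).
(* As [4 * (l + d) <= n], at most half of the ordered edges are unsuitable; this is the factor 2 in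
   the conclusion. *)
have h2 : n * d <= 2 * (n * d - 2 * (d * (l + d))).
  have : 4 * (d * (l + d)) <= n * d by rewrite mulnCA mulnC leq_mul2r nl orbT.
  lia.
apply: (@leq_trans (S * (2 * (n * d - 2 * (d * (l + d)))))).
  by rewrite leq_mul2l h2 orbT.
have -> : 2 * (nreg * T) * (n * d) = 2 * (nreg * (n * d * T)) by lia.
by rewrite mulnCA leq_mul2l h.
Qed.

Lemma sum_nbw_seg_eq K i m p (G : sgraph n) (sg : seq 'I_n) :
    regular_graph d G -> K = i + (m.+2 + p) -> size sg = m.+2 ->
  \sum_(s : K.-tuple 'I_n)
     (nbw (adj G) s && (take m.+2 (drop i s) == sg)) <= (d - 1) ^ (i + p).
Proof. by move=> regG ->; exact: sum_nbw_seg. Qed.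

(** A rooted cycle prescribes the [j - i + 1] vertices of the segment, and the other
    [k + 1 - (j - i)] vertices of the walk are extensions with at most [d - 1] choices each. *)
Lemma sum_on_cycle G k i j q : regular_graph d G -> i < j -> j < k.+2 ->
  \sum_(s : k.+2.-tuple 'I_n) (nbw (adj G) s && on_cycle (adj G) s i j q)
    <= nrooted (j - i + q) G * (d - 1) ^ (k.+1 - (j - i)).
Proof.
move=> regG ij jk.
pose F (c : (j - i + q).-tuple 'I_n) (s : seq 'I_n) :=
  nbw (adj G) s && (take (j - i).+1 (drop i s) == take (j - i).+1 (c ++ take 1 c)).
apply: (@leq_trans (\sum_(s : k.+2.-tuple 'I_n)
   \sum_(c : (j - i + q).-tuple 'I_n) (ucycleb (adj G) c * F c s))).
  apply: leq_sum => s _; case: (boolP (nbw _ _)) => // nb.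
  case: (boolP (on_cycle _ _ _ _ _)) => // /existsP[c /andP[cyc E]].
  by rewrite (bigD1 c) //= /F cyc nb E.
rewrite exchange_big /= /nrooted big_distrl /=; apply: leq_sum => c _.
rewrite -big_distrr /=; case: (boolP (ucycleb _ _)) => // _; rewrite !mul1n.
have -> : k.+1 - (j - i) = i + (k.+1 - j) by lia.
rewrite /F; have -> : (j - i).+1 = (j - i).-1.+2 by lia.
apply: sum_nbw_seg_eq => //; first by lia.
rewrite size_takel ?prednK ?subn_gt0 // size_cat size_tuple size_take size_tuple.
by case: ifP; lia.
Qed.

Definition nbad k G :=
  \sum_u \sum_(x : k.-tuple 'I_n) \sum_v
    (nbw (adj G) (u :: rcons x v) && ~~ good G k (u :: rcons x v)).

Definition ngood k G :=
  \sum_u \sum_(x : k.-tuple 'I_n) \sum_v good G k (u :: rcons x v).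

Lemma ngoodD k G : regular_graph d G ->
  ngood k G + nbad k G = n * d * (d - 1) ^ k.
Proof.
move=> regG; rewrite -(sum_nbw regG) -(sum_walk _ (fun s => nbw (adj G) s : nat)).
rewrite -big_split; apply: eq_bigr => u _; rewrite -big_split.
apply: eq_bigr => x _; rewrite -big_split; apply: eq_bigr => v _.
by have [/andP[-> _]|_] := boolP (good _ _ _); rewrite // andbT.
Qed.

Lemma nbad_le k G : regular_graph d G ->
  nbad k G <= \sum_(i < k.+2) \sum_(j < k.+2) \sum_(q < k)
    [&& i < j, q <= excursion_bound k i j & 2 < j - i + q] *
    (nrooted (j - i + q) G * (d - 1) ^ (k.+1 - (j - i))).
Proof.
move=> regG.
rewrite /nbad (sum_walk _ (fun s => nbw (adj G) s && ~~ good G k s : nat)).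
apply: (@leq_trans (\sum_(s : k.+2.-tuple 'I_n) \sum_(i < k.+2) \sum_(j < k.+2)
   \sum_(q < k) (nbw (adj G) s && clash_at G k s i j q))).
  apply: leq_sum => s _; rewrite /good; case: (boolP (nbw _ _)) => //= nb.
  rewrite negbK; case: existsP => // -[i /existsP[j /existsP[q cl]]].
  by rewrite (bigD1 i) //= (bigD1 j) //= (bigD1 q) //= cl.
rewrite exchange_big; apply: leq_sum => i _ /=.
rewrite exchange_big; apply: leq_sum => j _ /=.
rewrite exchange_big; apply: leq_sum => q _ /=.
have [/and3P[ij qb l2]|h] := boolP [&& _, _ & _]; last first.
  rewrite mul0n leqn0 sum_nat_eq0; apply/forall_inP => s _.
  rewrite eqb0; apply: contra h => /andP[_ /and4P[-> -> ->]].
  by [].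
rewrite mul1n; apply: leq_trans (sum_on_cycle _ regG ij (ltn_ord j)).
apply: leq_sum => s _; rewrite /clash_at ij qb l2 /=.
by [].
Qed.

Lemma sum_geom D k B : 1 < D ->
  \sum_(q < k) (q <= B) * D ^ q <= 2 * D ^ B.
Proof.
move=> D1; case: k => [|k]; first by rewrite big_ord0.
apply: (@leq_trans (2 * D ^ minn k B)); last first.
  by rewrite leq_mul2l leq_pexp2l ?geq_minr // ltnW.
elim: k => [|k IH]; first by rewrite big_ord_recl big_ord0 min0n.
rewrite big_ord_recr /=; have [kB|kB] := leqP k.+1 B; last first.
  by rewrite mul0n addn0 (leq_trans IH) // leq_mul2l leq_pexp2l ?(ltnW D1) //=; lia.
rewrite mul1n mul2n -addnn leq_add2r (leq_trans IH) //.
by rewrite (minn_idPl (ltnW kB)) expnS leq_mul2r D1 orbT.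
Qed.

(** Summing over [q] costs a factor 2. The row [i = 0] and the column [j = k + 1] then contribute at
    most [k + 2] terms [D ^ k.-1] each. For interior [i] the terms [D ^ (k - i)] decay
    geometrically, so the whole interior counts as two further rows: [2 * (1 + 1 + 2) = 8]. *)
Lemma sum_excursion_weights D k : 1 < D -> 0 < k ->
  \sum_(i < k.+2) \sum_(j < k.+2) \sum_(q < k)
    [&& i < j, q <= excursion_bound k i j & 2 < j - i + q] * D ^ q
  <= 8 * ((k + 2) * D ^ k.-1).
Proof.
move=> D1 k0.
apply: (@leq_trans (\sum_(i < k.+2) \sum_(j < k.+2) 2 *
   (((i == 0 :> nat) * D ^ k.-1) + ((j == k.+1 :> nat) * D ^ k.-1) +
    (0 < i <= k) * D ^ (k - i)))).
  apply: leq_sum => i _; apply: leq_sum => j _.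
  case: (boolP (i < j)) => ij; last by rewrite big1.
  apply: (@leq_trans (2 * D ^ excursion_bound k i j)).
    apply: leq_trans (sum_geom k _ D1); apply: leq_sum => q _.
    by rewrite leq_mul2r; case: (_ <= excursion_bound _ _ _); case: (2 < _); rewrite ?orbT.
  rewrite leq_mul2l /= /excursion_bound; have := ltn_ord j.
  case: (boolP (i == 0 :> nat)) => /= [_ _|i0]; first by rewrite mul1n -addnA leq_addr.
  case: (boolP (j == k.+1 :> nat)) => /= [_ _|j0 jk].
    by rewrite mul0n mul1n add0n leq_addr.
  by rewrite lt0n i0 (_ : i <= k) ?mul1n //; lia.
have E3 : \sum_(i < k.+2) (0 < i <= k) * D ^ (k - i) <= 2 * D ^ k.-1.
  rewrite big_ord_recl /= add0n big_ord_recr /= /bump /= add1n ltnn mul0n addn0.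
  rewrite (reindex_inj rev_ord_inj) /=.
  apply: leq_trans (sum_geom k k.-1 D1); apply: leq_sum => i _.
  have ik := ltn_ord i.
  rewrite /bump /= add1n (_ : k - (k - i.+1).+1 = i); last by lia.
  have -> : (i <= k.-1) = true by lia.
  by rewrite mul1n; case: (_ < _); rewrite ?mul1n ?mul0n.
have E1 : \sum_(i < k.+2) (i == 0 :> nat) * D ^ k.-1 = D ^ k.-1.
  by rewrite big_ord_recl /= mul1n big1 ?addn0.
have E2 : \sum_(i < k.+2) (i == k.+1 :> nat) * D ^ k.-1 = D ^ k.-1.
  rewrite big_ord_recr /= eqxx mul1n big1 ?add0n // => i _.
  by rewrite (_ : _ == _ = false) //; have := ltn_ord i; lia.
under eq_bigr do rewrite -big_distrr /=.
rewrite -big_distrr /=.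
under eq_bigr do rewrite !big_split /= E2 !sum_nat_const card_ord.
rewrite !big_split /= -!big_distrr /= E1 sum_nat_const card_ord.
by move: E3; set S := \sum_(_ < _) _; set T := D ^ _; nia.
Qed.

(** The segment length cancels: a cycle of length [j - i + q] has weight [(d - 1) ^ (j - i + q)] and
    its extensions [(d - 1) ^ (k + 1 - (j - i))], so only [(d - 1) ^ (k + 1 + q)] is left. The
    cycles that occur have length at most [2 k], hence the condition on [n]. *)
Lemma sum_nbad_le k : 2 < k -> 2 < d -> 0 < n -> 4 * (2 * k + d) <= n ->
  \sum_(G | regular_graph d G) nbad k G
    <= nreg * (16 * ((k + 2) * (d - 1) ^ (2 * k))).
Proof.
move=> k2 d2 n0 nk.
apply: (@leq_trans (\sum_(G | regular_graph d G)
    \sum_(i < k.+2) \sum_(j < k.+2) \sum_(q < k)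
    [&& i < j, q <= excursion_bound k i j & 2 < j - i + q] *
    (nrooted (j - i + q) G * (d - 1) ^ (k.+1 - (j - i))))).
  by apply: leq_sum => G; exact: nbad_le.
apply: (@leq_trans (\sum_(i < k.+2) \sum_(j < k.+2) \sum_(q < k)
   2 * nreg * (d - 1) ^ k.+1 *
    ([&& i < j, q <= excursion_bound k i j & 2 < j - i + q] * (d - 1) ^ q))).
  rewrite exchange_big; apply: leq_sum => i _ /=.
  rewrite exchange_big; apply: leq_sum => j _ /=.
  rewrite exchange_big; apply: leq_sum => q _ /=.
  rewrite -big_distrr /= mulnCA leq_mul2l -big_distrl /=.
  have [/and3P[ij _ l2]|] := boolP [&& _, _ & _] => //=.
  have ik := ltn_ord i; have jk := ltn_ord j; have qk := ltn_ord q.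
  have ->: 2 * nreg * (d - 1) ^ k.+1 * (d - 1) ^ q =
      2 * (nreg * (d - 1) ^ (j - i + q)) * (d - 1) ^ (k.+1 - (j - i)).
    rewrite -!mulnA -!expnD; congr (2 * (nreg * _ ^ _)); lia.
  rewrite leq_mul2r sum_nrooted_le2 ?orbT //; lia.
under eq_bigr do (under eq_bigr do rewrite -big_distrr /=).
under eq_bigr do rewrite -big_distrr /=.
rewrite -big_distrr /=.
have D1 : 1 < d - 1 by lia.
have := @sum_excursion_weights (d - 1) k D1 (ltnW (ltnW k2)).
set S := \sum_(_ < _) _ => hS.
apply: (leq_trans (leq_mul (leqnn _) hS)).
have -> : (d - 1) ^ (2 * k) = (d - 1) ^ k.+1 * (d - 1) ^ k.-1.
  by rewrite -expnD; congr (_ ^ _); lia.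
by rewrite -!mulnA; move: ((d - 1) ^ k.+1) ((d - 1) ^ k.-1) => A B; lia.
Qed.

End Counting.

From mathcomp Require Import all_order all_algebra ring lra.

Import Order.TTheory GRing.Theory Num.Theory.
Local Open Scope ring_scope.

(** * The approximate Stein identity for one cycle count *)

Section Stage.
Context (R : realFieldType) (n d k : nat).
Hypotheses (k2 : (2 < k)%N) (d2 : (2 < d)%N) (n0 : (0 < n)%N).
Hypothesis nk : (4 * (2 * k + d) <= n)%N.
Implicit Types G H : sgraph n.

(** These are the good switchings that arrive at [H]: [flip] being an involution, the source graph
    is recovered from [H] and the walk. *)
Definition nforward H := (\sum_u \sum_(x : k.-tuple 'I_n) \sum_v
  (regular_graph d (flip (walk_quad u x v) H) &&
   good (flip (walk_quad u x v) H) k (u :: rcons x v)))%N.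

Let walk_quadk u (x : k.-tuple 'I_n) v : walk_quad u x v =
  quad u (nth u (u :: rcons x v) 1) (nth u (u :: rcons x v) k) v.
Proof. by rewrite /walk_quad size_tuple. Qed.

(** A good switching that arrives at [H] leaves its traces there: [x] is a rooted cycle and [u v] an
    ordered edge of [H], and together they determine the walk. *)
Lemma nforward_le H : regular_graph d H ->
  (nforward H <= nrooted k H * (n * d))%N.
Proof.
move=> regH.
have -> : (n * d = \sum_(u < n) \sum_v adj H u v)%N.
  rewrite (eq_bigr (fun=> d)) => [|u _]; last exact: sum_adj.
  by rewrite big_const_ord iter_addn_0 mulnC.
rewrite /nforward exchange_big /= /nrooted big_distrl /=; apply: leq_sum => x _.
rewrite big_distrr /=; apply: leq_sum => u _.
rewrite big_distrr /=; apply: leq_sum => v _.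
case: (boolP (_ && _)) => // /andP[_ gd].
have := good_ucycle_x k2 (size_tuple x) gd.
have := adj_flip_uv k2 (size_tuple x) gd.
by rewrite -walk_quadk flipK => -> ->.
Qed.

(* Double counting of the switchings, by their initial and by their final graph. *)
Lemma sum_switch (f : sgraph n -> R) :
  \sum_(G | regular_graph d G) \sum_u \sum_(x : k.-tuple 'I_n) \sum_v
     (good G k (u :: rcons x v))%:R * f (flip (walk_quad u x v) G) =
  \sum_(H | regular_graph d H) (nforward H)%:R * f H.
Proof.
pose E u (x : k.-tuple 'I_n) v :=
  \sum_(H | regular_graph d H)
    (regular_graph d (flip (walk_quad u x v) H) &&
     good (flip (walk_quad u x v) H) k (u :: rcons x v))%:R * f H.
transitivity (\sum_u \sum_(x : k.-tuple 'I_n) \sum_v E u x v); last first.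
  under eq_bigr do (under eq_bigr do rewrite exchange_big /=).
  under eq_bigr do rewrite exchange_big /=.
  rewrite exchange_big /=; apply: eq_bigr => H _.
  rewrite /nforward natr_sum mulr_suml; apply: eq_bigr => u _.
  rewrite natr_sum mulr_suml; apply: eq_bigr => x _.
  by rewrite natr_sum mulr_suml.
rewrite exchange_big /=; apply: eq_bigr => u _.
rewrite exchange_big /=; apply: eq_bigr => x _.
rewrite exchange_big /=; apply: eq_bigr => v _.
rewrite /E big_mkcond [RHS]big_mkcond /=.
rewrite [RHS](reindex_inj (inv_inj (flipK (walk_quad u x v)))) /=.
apply: eq_bigr => G _; rewrite flipK.
case: (boolP (good _ _ _)) => gd; last by rewrite andbF !mul0r !if_same.
rewrite andbT; case: (boolP (regular_graph d G)) => regG; last first.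
  by rewrite mul0r if_same.
have := good_regular k2 (size_tuple x) gd regG.
by rewrite -walk_quadk => ->.
Qed.

Lemma switching_error_le :
  (32 * ((k + 2) * (d - 1) ^ (2 * k)) + 4 * (d * ((k + d) * (d - 1) ^ k))
   <= 60 * (k * (d * (d - 1) ^ (2 * k - 1))))%N.
Proof.
have -> : ((d - 1) ^ (2 * k) = (d - 1) * (d - 1) ^ (2 * k - 1))%N.
  by rewrite -expnS; congr (_ ^ _)%N; lia.
have : ((d - 1) * (d - 1) ^ k <= (d - 1) ^ (2 * k - 1))%N.
  by rewrite -expnS leq_pexp2l; lia.
move: ((d - 1) ^ (2 * k - 1))%N ((d - 1) ^ k)%N => X Y XY.
(* From [3 <= k] follows [k + 2 <= 5 k / 3], and [32 * 5 / 3 < 54]. *)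
have h1 : (32 * ((k + 2) * ((d - 1) * X)) <= 54 * (k * (d * X)))%N.
  by rewrite !mulnA leq_mul2r; apply/orP; right; nia.
(* Here [k + d <= k d] and [2 d <= 3 (d - 1)], which turns the factor 4 into 6. *)
have h2 : (4 * (d * ((k + d) * Y)) <= 6 * (k * (d * X)))%N.
  apply: (@leq_trans (4 * (d * (k * d * Y)))).
    by rewrite !leq_mul2l leq_mul2r; do 3![apply/orP; right]; nia.
  apply: (@leq_trans (6 * (k * (d * ((d - 1) * Y))))); last first.
    by rewrite !leq_mul2l XY !orbT.
  have : (2 * d <= 3 * (d - 1))%N by lia.
  move=> h.
  have -> : (4 * (d * (k * d * Y)) = 2 * (k * d * Y) * (2 * d))%N by lia.
  have -> : (6 * (k * (d * ((d - 1) * Y))) = 2 * (k * d * Y) * (3 * (d - 1)))%N by lia.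
  by rewrite leq_mul2l h orbT.
have -> : (60 * (k * (d * X)) = 54 * (k * (d * X)) + 6 * (k * (d * X)))%N by lia.
exact: leq_add.
Qed.

Context (g : nat -> sgraph n -> R) (xi : R).
Hypothesis g_le : forall m G, `|g m G| <= xi.
Hypothesis g_eq : forall m G H,
  (forall j, (2 < j < k)%N -> ncycles G j = ncycles H j) -> g m G = g m H.

(* Both a lam - ngood and a C_k - nforward, with a = 2 k n d, are nonnegative, so
   their absolute values may be dropped in expectation; as ngood and nforward
   have the same expectation, only nbad and the mean of nrooted remain. *)
Lemma stein_stage :
  `|\sum_(G | regular_graph d G)
      ((d - 1)%:R ^+ k / (2 * k)%:R * g (ncycles G k).+1 G
        - (ncycles G k)%:R * g (ncycles G k) G)|
   <= xi * (30 * (d - 1)%:R ^+ (2 * k - 1) / n%:R) * (nreg n d)%:R.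
Proof.
have xi0 : 0 <= xi.
  have G0 : sgraph n by exists set0; apply/forall_inP => e; rewrite inE.
  exact: le_trans (normr_ge0 _) (g_le 0 G0).
pose C G : R := (ncycles G k)%:R.
(* This is the exact part of the identity: along a good switching, [g] at [C_k + 1] for the source
   equals [g] at [C_k] for the target, since the shorter counts agree. *)
have S1 : \sum_(G | regular_graph d G) (ngood k G)%:R * g (ncycles G k).+1 G =
          \sum_(H | regular_graph d H) (nforward H)%:R * g (ncycles H k) H.
  rewrite -(sum_switch (fun H => g (ncycles H k) H)); apply: eq_bigr => G _.
  rewrite /ngood natr_sum mulr_suml; apply: eq_bigr => u _.
  rewrite natr_sum mulr_suml; apply: eq_bigr => x _.
  rewrite natr_sum mulr_suml; apply: eq_bigr => v _.
  case: (boolP (good _ _ _)) => gd; last by rewrite !mul0r.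
  congr (_ * _); have := good_ncycles k2 (size_tuple x) gd.
  rewrite -walk_quadk => ->; apply: g_eq => j jk.
  by have := good_ncycles_lt k2 (size_tuple x) gd jk; rewrite -walk_quadk.
have S0 : \sum_(G : sgraph n | regular_graph d G) (ngood k G)%:R =
          \sum_(H : sgraph n | regular_graph d H) (nforward H)%:R :> R.
  transitivity (\sum_(H | regular_graph d H) (nforward H)%:R * 1 : R); last first.
    by apply: eq_bigr => H _; rewrite mulr1.
  rewrite -(sum_switch (fun=> 1)); apply: eq_bigr => G _.
  rewrite /ngood natr_sum; apply: eq_bigr => u _.
  rewrite natr_sum; apply: eq_bigr => x _.
  by rewrite natr_sum; apply: eq_bigr => v _; rewrite mulr1.
have CE G : (2 * k)%:R * C G = (nrooted k G)%:R.
  by rewrite -natrM /nrooted sum_ucycle.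
have kn0 : (2 * k)%:R != 0 :> R by rewrite pnatr_eq0; lia.
have nd0 : 0 < (n * d)%:R :> R by rewrite ltr0n; nia.
pose a : R := (2 * k)%:R * (n * d)%:R.
have a0 : 0 < a by rewrite mulr_gt0 // ltr0n; lia.
rewrite -(ler_pM2l a0) -{1}(gtr0_norm a0) -normrM mulr_sumr.
have -> : \sum_(G | regular_graph d G) a *
    ((d - 1)%:R ^+ k / (2 * k)%:R * g (ncycles G k).+1 G
        - (ncycles G k)%:R * g (ncycles G k) G) =
  \sum_(G | regular_graph d G) (nbad k G)%:R * g (ncycles G k).+1 G -
  \sum_(G | regular_graph d G)
     ((nrooted k G * (n * d))%:R - (nforward G)%:R) * g (ncycles G k) G.
  under [X in _ = _ - X]eq_bigr do rewrite mulrBl.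
  rewrite sumrB -S1 opprB addrA -big_split -sumrB /=.
  apply: eq_bigr => G regG.
  rewrite -mulrDl -natrD addnC (ngoodD _ regG) (natrM _ (n * d)%N) natrX.
  rewrite (natrM _ (nrooted k G)) -CE /a /C.
  by move: ((2 * k)%:R : R) kn0 => K K0; field.
apply: le_trans (ler_normB _ _) _.
have B1 : `|\sum_(G | regular_graph d G) (nbad k G)%:R * g (ncycles G k).+1 G|
   <= xi * (\sum_(G : sgraph n | regular_graph d G) nbad k G)%N%:R.
  apply: le_trans (ler_norm_sum _ _ _) _.
  rewrite natr_sum mulr_sumr; apply: ler_sum => G _.
  by rewrite normrM mulrC normr_nat ler_wpM2r.
have B2 : `|\sum_(G | regular_graph d G)
     ((nrooted k G * (n * d))%:R - (nforward G)%:R) * g (ncycles G k) G|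
   <= xi * (\sum_(G | regular_graph d G)
              ((nrooted k G * (n * d))%:R - (nforward G)%:R)).
  apply: le_trans (ler_norm_sum _ _ _) _.
  rewrite mulr_sumr; apply: ler_sum => G regG.
  have h : 0 <= (nrooted k G * (n * d))%:R - (nforward G)%:R :> R.
    by rewrite subr_ge0 ler_nat nforward_le.
  by rewrite normrM mulrC (ger0_norm h) ler_wpM2r.
apply: le_trans (lerD B1 B2) _.
rewrite -mulrDr.
have -> : a * (xi * (30 * (d - 1)%:R ^+ (2 * k - 1) / n%:R) * (nreg n d)%:R) =
  xi * (nreg n d * (60 * (k * (d * (d - 1) ^ (2 * k - 1)))))%N%:R.
  rewrite /a !natrM natrX; field.
  by rewrite pnatr_eq0; lia.
apply: ler_wpM2l => //.
rewrite sumrB -S0.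
have -> : \sum_(G : sgraph n | regular_graph d G) (ngood k G)%:R =
   (nreg n d * (n * d * (d - 1) ^ k))%:R -
   (\sum_(G : sgraph n | regular_graph d G) nbad k G)%N%:R :> R.
  apply/eqP; rewrite -subr_eq opprK addrC eq_sym; apply/eqP.
  rewrite natr_sum -big_split /= /nreg big_distrl natr_sum /=.
  rewrite [RHS]big_mkcond /=; apply: eq_bigr => G _.
  case: (boolP (regular_graph d G)) => regG; last by rewrite mul0n.
  by rewrite mul1n -(ngoodD _ regG) natrD addrC.
have nb := sum_nbad_le k2 d2 n0 nk.
have nr2 : (\sum_(G : sgraph n | regular_graph d G) nrooted k G
    <= 2 * (nreg n d * (d - 1) ^ k))%N.
  by apply: sum_nrooted_le2 => //; lia.
have nr := sum_nrooted_le n d k2.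
have er := switching_error_le.
rewrite opprB addrCA !addrA -natr_sum -!natrD lerBlDr -!natrD ler_nat.
move: nb nr nr2 er; rewrite -!big_distrl /=.
set A := (\sum_(G | _) nbad k G)%N; set N := (\sum_(G | _) nrooted k G)%N.
set M := nreg n d; set X := ((d - 1) ^ (2 * k))%N; set Y := ((d - 1) ^ k)%N.
set Z := ((d - 1) ^ (2 * k - 1))%N.
move=> nb nr nr2 er.
(* The sharp mean bound [nr] accounts for the suitable edges; for the lower-order rest, from the
   unsuitable ones, the bound [nr2] with its factor 2 suffices. *)
have e1 : (N * (n * d) <= N * (n * d - 2 * (d * (k + d))) + N * (2 * (d * (k + d))))%N.
  by rewrite -mulnDr leq_mul2l; apply/orP; right; lia.
have e2 : (N * (2 * (d * (k + d))) <= 2 * (M * Y) * (2 * (d * (k + d))))%N.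
  by rewrite leq_mul2r nr2 orbT.
have e3 : (M * (32 * ((k + 2) * X) + 4 * (d * ((k + d) * Y))) <=
  M * (60 * (k * (d * Z))))%N by rewrite leq_mul2l er orbT.
have -> : (N * (n * d) + A + A = 2 * A + N * (n * d))%N by lia.
have e4 : (2 * (M * Y) * (2 * (d * (k + d))) = M * (4 * (d * ((k + d) * Y))))%N by lia.
have e5 : (2 * (M * (16 * ((k + 2) * X))) = M * (32 * ((k + 2) * X)))%N by lia.
move: e3; rewrite mulnDr -e4 -e5; lia.
Qed.

End Stage.

From mathcomp Require Import finmap.
From mathcomp Require Import all_classical all_reals all_analysis.

Import numFieldNormedType.Exports.
Local Open Scope classical_set_scope.

(** * The Stein equation of the Poisson law *)

Section SteinPoisson.
Context {R : realType} (lam : R).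
Hypothesis lam1 : 1 <= lam.

Lemma rate_gt0 : 0 < lam. Proof. exact: lt_le_trans lam1. Qed.
#[local] Hint Resolve rate_gt0 : core.

Local Notation p := (poisson_pmf lam).

Lemma poisson_pmf_gt0 j : 0 < p j.
Proof.
by rewrite /poisson_pmf rate_gt0 mulr_gt0 ?expR_gt0 // mulr_gt0 ?exprn_gt0.
Qed.

Lemma poisson_pmfS j : j.+1%:R * p j.+1 = lam * p j.
Proof.
rewrite /poisson_pmf rate_gt0 factS natrM exprS.
have h1 : j.+1%:R != 0 :> R by rewrite pnatr_eq0.
have h2 : j`!%:R != 0 :> R by rewrite pnatr_eq0 -lt0n fact_gt0.
by rewrite invfM; field; rewrite h2 addrC natr1 h1.
Qed.

Lemma cvg_poisson_pmf : series p @ \oo --> (1 : R).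
Proof.
have -> : series p = (fun n => expR (- lam) * series (exp_coeff lam) n).
  apply/funext => n; rewrite /series /= mulr_sumr; apply: eq_bigr => i _.
  by rewrite /poisson_pmf rate_gt0 /exp_coeff mulrC.
have -> : (1 : R) = expR (- lam) * expR lam by rewrite expRN mulVf // gt_eqF ?expR_gt0.
exact: cvgMr (is_cvg_series_exp_coeff lam).
Qed.

(* Bounds p (x - i) / p x for x <= lam and p (x + i) / p x for x >= lam. *)
Definition ratio_bound i := \prod_(l < i) (lam / (lam + l%:R)).

Lemma ratio_boundS i : ratio_bound i.+1 = ratio_bound i * (lam / (lam + i%:R)).
Proof. by rewrite /ratio_bound big_ord_recr. Qed.

Lemma ratio_bound_ge0 i : 0 <= ratio_bound i.
Proof. by apply: prodr_ge0 => l _; rewrite divr_ge0 ?addr_ge0 // ltW. Qed.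

(** The inverse of [ratio_bound i] is the product of the [1 + l / lam] over [l < i], at least
    [1 + i (i - 1) / (2 lam)] by its first-order terms. *)
Lemma ratio_bound_le i : ratio_bound i * (2 * lam + i%:R * (i%:R - 1)) <= 2 * lam.
Proof.
elim: i => [|i IH]; first by rewrite /ratio_bound big_ord0; lra.
apply: le_trans IH; rewrite ratio_boundS -mulrA.
apply: ler_wpM2l; first exact: ratio_bound_ge0.
have i0 : 0 <= i%:R :> R by [].
have li0 : 0 < lam + i%:R by rewrite ltr_wpDr.
rewrite mulrAC ler_pdivrMr // -natr1.
have : i%:R * i%:R <= i%:R * i%:R * i%:R :> R.
  by rewrite -!natrM ler_nat; case: (i) => // j; rewrite leq_pmulr.
nra.
Qed.

Local Notation m := (Num.sqrt (2 * lam)).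

Lemma sqrt2_gt0 : 0 < m.
Proof. by rewrite sqrtr_gt0 mulr_gt0. Qed.
#[local] Hint Resolve sqrt2_gt0 : core.

Lemma sqrt2_sqr : m * m = 2 * lam.
Proof. by rewrite -expr2 sqr_sqrtr // mulr_ge0 // ltW. Qed.

(** The hypothesis [1 <= lam] absorbs the additive 2, and [3 / 2] exceeds the square root of 2. The
    constant 5 of the Stein bound arises here. *)
Lemma sqrt2_le : 2 + 2 * m <= 5 * Num.sqrt lam.
Proof.
have s1 : 1 <= Num.sqrt lam by rewrite -[1]sqrtr1 ler_wsqrtr.
suff : m <= 3 / 2 * Num.sqrt lam by lra.
rewrite -(@ler_pXn2r _ 2) ?nnegrE ?mulr_ge0 ?sqrtr_ge0 //.
have l0 := rate_gt0.
have -> : m ^+ 2 = 2 * lam by rewrite sqr_sqrtr // mulr_ge0 // ltW.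
have -> : (3 / 2 * Num.sqrt lam) ^+ 2 = 9 / 4 * lam.
  by rewrite exprMn sqr_sqrtr; [field|exact: ltW].
lra.
Qed.

(** With [t = N + 1], the next term is at most [m^2 / (m^2 + t^2)], and [(m + t)^2 <= 2 (m^2 + t^2)]
    bounds this by the telescoping difference [2 m^2 (1 / (m + t - 1) - 1 / (m + t))]. The
    subtracted fraction makes the induction close, with equality at [N = 0]. *)
Lemma sum_ratio_bound_aux N :
  \sum_(i < N.+2) ratio_bound i <= 2 + 2 * m - 2 * (m * m) / (m + N%:R).
Proof.
elim: N => [|N IH].
  rewrite !big_ord_recr big_ord0 /= ratio_boundS /ratio_bound big_ord0 addr0.
  rewrite add0r mul1r divff ?gt_eqF // addr0.
  by rewrite mulrA mulfK ?gt_eqF //; lra.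
rewrite big_ord_recr /=; apply: le_trans (lerD IH (lexx _)) _.
have N0 : 0 <= N%:R :> R by [].
have mN : 0 < m + N%:R by rewrite ltr_wpDr.
have mN1 : 0 < m + N.+1%:R by rewrite ltr_wpDr.
suff h : ratio_bound N.+2 <=
    2 * (m * m) * ((m + N%:R)^-1 - (m + N.+1%:R)^-1) by rewrite mulrBr in h; lra.
pose t : R := N.+1%:R.
have tE : N%:R = t - 1 by rewrite /t -natr1 addrK.
have t1 : 1 <= t by rewrite /t ler1n.
have den : 0 < m * m + t * t by rewrite addr_gt0 ?mulr_gt0 //; lra.
have h : ratio_bound N.+2 <= m * m / (m * m + t * t).
  rewrite ler_pdivlMr //; apply: le_trans (_ : _ <= 2 * lam) _; last by rewrite sqrt2_sqr.
  apply: le_trans (ratio_bound_le N.+2); apply: ler_wpM2l.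
    exact: ratio_bound_ge0.
  rewrite sqrt2_sqr -[N.+2%:R]natr1 -/t; nra.
apply: le_trans h _; rewrite -/t tE.
have -> : 2 * (m * m) * ((m + (t - 1))^-1 - (m + t)^-1) =
  m * m * (2 / ((m + (t - 1)) * (m + t))).
  have -> : (m + (t - 1))^-1 - (m + t)^-1 =
      ((m + t) - (m + (t - 1))) / ((m + (t - 1)) * (m + t)).
    move: mN mN1; rewrite -/t tE; move: (m + (t - 1)) (m + t) => x y x0 y0.
    by field; rewrite !gt_eqF.
  have -> : m + t - (m + (t - 1)) = 1 by ring.
  by rewrite mul1r; move: (_^-1) => z; ring.
apply: ler_wpM2l; first by rewrite mulr_ge0 // ltW.
rewrite tE in mN; rewrite -/t in mN1.
rewrite ler_pdivlMr ?mulr_gt0 // mulrC ler_pdivrMr //.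
have := sqr_ge0 (m - t); rewrite expr2; nra.
Qed.

Lemma sum_ratio_bound N : \sum_(i < N) ratio_bound i <= 2 + 2 * m.
Proof.
apply: (@le_trans _ _ (\sum_(i < N.+2) ratio_bound i)).
  rewrite !big_ord_recr /= -addrA lerDl addr_ge0 //; exact: ratio_bound_ge0.
apply: le_trans (sum_ratio_bound_aux N) _.
rewrite lerBlDr lerDl divr_ge0 // ?mulr_ge0 ?addr_ge0 // ltW.
Qed.

Lemma poisson_pmf_below x i : x%:R <= lam -> (i <= x)%N ->
  p (x - i)%N <= p x * ratio_bound i.
Proof.
move=> xl; elim: i => [|i IH] ix; first by rewrite subn0 /ratio_bound big_ord0 mulr1.
rewrite ratio_boundS mulrA.
have li0 : 0 < lam + i%:R by rewrite ltr_wpDr.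
have E : (x - i)%:R * p (x - i)%N = lam * p (x - i.+1)%N.
  by rewrite -poisson_pmfS (_ : (x - i.+1).+1 = (x - i)%N) //; lia.
have -> : p (x - i.+1)%N = p (x - i)%N * ((x - i)%:R / lam).
  by rewrite mulrA [_ * (x - i)%:R]mulrC E [lam * _]mulrC mulfK ?gt_eqF.
apply: ler_pM => //; try exact: ltW (poisson_pmf_gt0 _).
- by rewrite divr_ge0 // ltW.
- by apply: IH; exact: ltnW.
rewrite ler_pdivrMr // mulrAC ler_pdivlMr //.
rewrite natrB 1?ltnW //; have : 0 <= i%:R :> R by []; nra.
Qed.

Lemma poisson_pmf_above x i : lam <= x%:R -> p (x + i)%N <= p x * ratio_bound i.
Proof.
move=> xl; elim: i => [|i IH]; first by rewrite addn0 /ratio_bound big_ord0 mulr1.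
rewrite ratio_boundS mulrA.
have li0 : 0 < lam + i%:R by rewrite ltr_wpDr.
have xi0 : 0 < (x + i).+1%:R :> R by rewrite ltr0n.
have -> : p (x + i.+1)%N = p (x + i)%N * (lam / (x + i).+1%:R).
  rewrite mulrA [p (x + i)%N * lam]mulrC -poisson_pmfS mulrC mulKf ?addnS //.
apply: ler_pM => //; try exact: ltW (poisson_pmf_gt0 _).
  by rewrite divr_ge0 // ltW.
rewrite ler_pM2l // lef_pV2 ?posrE // -natr1 natrD; lra.
Qed.

(** Multiplied by [p x], the Stein equation [lam g(x+1) - x g(x) = f x - fbar] has a telescoping
    left side, because [x p(x) = lam p(x-1)]. Its solution is therefore a quotient of partial
    sums. *)
Definition stein_sol (f : nat -> R) (fbar : R) (x : nat) : R :=
  if x is y.+1 then (\sum_(0 <= j < y.+1) p j * (f j - fbar)) / (lam * p y)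
  else 0.

Lemma stein_solE f fbar x :
  lam * stein_sol f fbar x.+1 - x%:R * stein_sol f fbar x = f x - fbar.
Proof.
have px := poisson_pmf_gt0 x.
rewrite /= big_nat_recr //=; case: x px => [|x] px /=.
  by rewrite big_nil; field; rewrite !gt_eqF.
have := poisson_pmf_gt0 x => px'.
have -> : lam * p x = x.+1%:R * p x.+1 by rewrite poisson_pmfS.
by field; rewrite !gt_eqF // addrC natr1 ltr0n.
Qed.

(** Up to the mean, the partial sum is bounded term by term, going down from [x]. Beyond the mean,
    centering makes the full series vanish, so the partial sum is minus the tail, which is bounded
    going up from [x]. Either way it is at most [p x] times a sum of [ratio_bound]. *)
Lemma stein_sol_le f fbar x : (forall j, `|f j - fbar| <= 1) ->
    series (fun j => p j * (f j - fbar)) @ \oo --> (0 : R) ->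
  `|stein_sol f fbar x| <= 5 / Num.sqrt lam.
Proof.
move=> f1 cv; have sl0 : 0 < Num.sqrt lam by rewrite sqrtr_gt0.
have B0 : 0 <= 5 / Num.sqrt lam by rewrite divr_ge0 // ltW.
case: x => [|x] /=; first by rewrite normr0.
have px := poisson_pmf_gt0 x.
have pf j : `|p j * (f j - fbar)| <= p j.
  rewrite normrM (gtr0_norm (poisson_pmf_gt0 j)) -{2}[p j]mulr1.
  by rewrite ler_pM2l ?poisson_pmf_gt0.
set S := \sum_(0 <= j < x.+1) _.
suff hS : `|S| <= p x * (2 + 2 * m).
  rewrite normrM normfV (gtr0_norm (_ : 0 < lam * p x)) ?mulr_gt0 //.
  rewrite ler_pdivrMr ?mulr_gt0 //; apply: le_trans hS _.
  rewrite [lam * _]mulrC mulrCA ler_pM2l //.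
  rewrite [X in _ / _ * X](_ : lam = Num.sqrt lam * Num.sqrt lam); last first.
    by rewrite -expr2 sqr_sqrtr // ltW.
  rewrite mulrA mulfVK ?gt_eqF //.
  exact: sqrt2_le.
have [xl|xl] := leP x%:R lam.
  apply: le_trans (ler_norm_sum _ _ _) _.
  apply: (@le_trans _ _ (\sum_(0 <= j < x.+1) p j)); first exact: ler_sum.
  rewrite big_mkord (reindex_inj rev_ord_inj) /=.
  apply: (@le_trans _ _ (\sum_(i < x.+1) p x * ratio_bound i)).
    apply: ler_sum => i _; rewrite subSS; apply: poisson_pmf_below => //.
    by rewrite -ltnS.
  by rewrite -mulr_sumr ler_pM2l // sum_ratio_bound.
apply/ler_addgt0Pr => e e0.
have [N _ hN] : \forall N \near \oo, `|series (fun j => p j * (f j - fbar)) N| < e.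
  by have /cvgr0_norm_lt := cv; apply.
pose K := maxn N x.+1.
have xK : (x.+1 <= K)%N by rewrite leq_maxr.
have hK : `|series (fun j => p j * (f j - fbar)) K| < e by apply: hN; rewrite /= leq_maxl.
have E : S = series (fun j => p j * (f j - fbar)) K - \sum_(x.+1 <= j < K) p j * (f j - fbar).
  by rewrite /series /= (big_cat_nat _ xK) //= addrK.
rewrite E; apply: le_trans (ler_normB _ _) _; rewrite addrC.
apply: lerD; last exact: ltW.
apply: le_trans (ler_norm_sum _ _ _) _.
apply: (@le_trans _ _ (\sum_(x.+1 <= j < K) p j)); first exact: ler_sum.
rewrite -{1}[x.+1]add0n big_addn big_mkord.
apply: (@le_trans _ _ (\sum_(i < K - x.+1) p x * ratio_bound i.+1)).
  by apply: ler_sum => i _; rewrite addnC addSnnS; apply: poisson_pmf_above; exact: ltW.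
rewrite -mulr_sumr ler_pM2l //.
apply: le_trans (sum_ratio_bound (K - x.+1).+1).
by rewrite big_ord_recl lerDr ratio_bound_ge0.
Qed.

End SteinPoisson.

(** * Replacing the counts one at a time *)

Section PoissonAverage.
Context {R : realType}.

Section OneCoordinate.
Context (lam : R) (f : nat -> R).
Hypotheses (lam1 : 1 <= lam) (f01 : forall j, 0 <= f j <= 1).
Local Notation p := (poisson_pmf lam).

Lemma poisson_series_le1 N : series p N <= 1.
Proof.
have := cvg_poisson_pmf lam1; move=> /[dup] /cvg_lim <- // h.
apply: nondecreasing_cvgn_le; last exact: h.
apply: nondecreasing_series => i _ _; exact: poisson_pmf_ge0.
Qed.

Lemma is_cvg_poisson_series : cvgn (series (fun j => p j * f j)).
Proof.
apply: nondecreasing_is_cvgn.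
  apply: nondecreasing_series => i _ _; rewrite mulr_ge0 ?poisson_pmf_ge0 //.
  by case/andP: (f01 i).
exists 1 => _ [N _ <-]; apply: le_trans (poisson_series_le1 N).
apply: ler_sum => i _; rewrite ler_piMr ?poisson_pmf_ge0 //.
by case/andP: (f01 i).
Qed.

Lemma poisson_avg01 : 0 <= limn (series (fun j => p j * f j)) <= 1.
Proof.
have cv := is_cvg_poisson_series; apply/andP; split.
  apply: limr_ge => //; near=> N; apply: sumr_ge0 => i _.
  by rewrite mulr_ge0 ?poisson_pmf_ge0 //; case/andP: (f01 i).
apply: limr_le => //; near=> N; apply: le_trans (poisson_series_le1 N).
apply: ler_sum => i _; rewrite ler_piMr ?poisson_pmf_ge0 //.
by case/andP: (f01 i).
Unshelve. all: by end_near. Qed.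

Lemma cvg_poisson_centered :
  series (fun j => p j * (f j - limn (series (fun j => p j * f j)))) @ \oo
    --> (0 : R).
Proof.
set L := limn _.
have -> : series (fun j => p j * (f j - L)) =
    (fun N => series (fun j => p j * f j) N - series p N * L).
  apply/funext => N; rewrite /series /= mulr_suml -sumrB.
  by apply: eq_bigr => i _; rewrite mulrBr.
rewrite [X in _ --> X](_ : 0 = L - 1 * L); last by rewrite mul1r subrr.
apply: cvgB; first exact: is_cvg_poisson_series.
by apply: cvgMl; exact: cvg_poisson_pmf.
Qed.

End OneCoordinate.

Definition upd (w : nat -> nat) k j : nat -> nat :=
  fun i => if i == k then j else w i.

Lemma upd_id w k : upd w k (w k) = w.
Proof. by apply/funext => i; rewrite /upd; case: eqP => // ->. Qed.

Section Average.
Context (lam : nat -> R) (r : nat) (h : (nat -> nat) -> R).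
Hypothesis lam1 : forall k, (2 < k)%N -> 1 <= lam k.
Hypothesis h01 : forall w, 0 <= h w <= 1.
Hypothesis h_eq : forall w w', (forall i, (2 < i <= r)%N -> w i = w' i) ->
  h w = h w'.

(* Averages out the m coordinates r, r - 1, ..., r - m + 1. *)
Fixpoint avg m (w : nat -> nat) : R :=
  if m is m'.+1 then
    limn (series (fun j => poisson_pmf (lam (r - m')) j *
                           avg m' (upd w (r - m')%N j)))
  else h w.

Lemma avg01 m w : (m <= r - 2)%N -> 0 <= avg m w <= 1.
Proof.
elim: m w => [|m IH] w mr; first exact: h01.
by apply: poisson_avg01 => [|j]; [apply: lam1; lia | apply: IH; exact: ltnW].
Qed.

(** Averaging removes the dependence on the averaged coordinates. In the stage for [C_k] the Stein
    solution is thus a function of the counts shorter than [k], exactly those that good switchings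
    preserve. *)
Lemma avg_eq m w w' : (forall i, (2 < i <= r - m)%N -> w i = w' i) ->
  avg m w = avg m w'.
Proof.
elim: m w w' => [|m IH] w w' E.
  by apply: h_eq => i ir; apply: E; rewrite subn0.
rewrite /=; congr (limn (series _)); apply/funext => j; congr (_ * _).
apply: IH => i ir; rewrite /upd; case: eqP => // ik; apply: E; lia.
Qed.

End Average.
End PoissonAverage.

Definition rate {R : realType} (d k : nat) : R := (d - 1)%:R ^+ k / (2 * k)%:R.

(** For [3 <= k] one has [2 k <= 2 ^ k <= (d - 1) ^ k]. This makes the Stein bound applicable at
    every stage. *)
Lemma rate_ge1 (R : realType) (d k : nat) : (2 < d)%N -> (2 < k)%N ->
  1 <= rate d k :> R.
Proof.
move=> d2 k2; rewrite /rate ler_pdivlMr ?mul1r ?ltr0n; last by lia.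
rewrite -natrX ler_nat; apply: (@leq_trans (2 ^ k)); last first.
  by rewrite leq_exp2r; lia.
elim: k k2 {d2} => // k IH; rewrite ltnS leq_eqVlt => /orP[/eqP <- //|k2].
by rewrite expnS; have := IH k2; lia.
Qed.

Section Telescoping.
Context {R : realType} (n r d : nat) (h : (nat -> nat) -> R).
Hypotheses (n0 : (0 < n)%N) (d2 : (2 < d)%N).
Hypothesis nr : (4 * (2 * r + d) <= n)%N.
Hypothesis h01 : forall w, 0 <= h w <= 1.
Hypothesis h_eq : forall w w', (forall i, (2 < i <= r)%N -> w i = w' i) ->
  h w = h w'.

Definition stage_error k : R :=
  5 / Num.sqrt (rate d k) * (30 * (d - 1)%:R ^+ (2 * k - 1) / n%:R).

Lemma stage m : (m < r - 2)%N ->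
  `|\sum_(G : sgraph n | regular_graph d G)
      (avg (rate d) r h m (ncycles G) - avg (rate d) r h m.+1 (ncycles G))|
    <= stage_error (r - m) * (nreg n d)%:R.
Proof.
move=> mr; set k := (r - m)%N.
have k2 : (2 < k)%N by rewrite /k; lia.
have l1 := @rate_ge1 R d k d2 k2.
(* [f G] is the current test function along coordinate [k], with the shorter counts frozen at those
   of [G]. Its value at [C_k] is [avg m] and its Poisson mean is [avg m.+1], so the Stein equation
   expresses their difference. *)
pose f (G : sgraph n) j := avg (rate d) r h m (upd (ncycles G) k j).
have f01 G j : 0 <= f G j <= 1 by apply: avg01 => //; [by move=> i; exact: rate_ge1|exact: ltnW].
pose g j (G : sgraph n) := stein_sol (rate d k) (f G) (avg (rate d) r h m.+1 (ncycles G)) j.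
have -> : \sum_(G : sgraph n | regular_graph d G)
      (avg (rate d) r h m (ncycles G) - avg (rate d) r h m.+1 (ncycles G)) =
   \sum_(G : sgraph n | regular_graph d G)
      ((d - 1)%:R ^+ k / (2 * k)%:R * g (ncycles G k).+1 G
        - (ncycles G k)%:R * g (ncycles G k) G).
  apply: eq_bigr => G _; rewrite -/(rate d k) /g stein_solE // /f upd_id.
  by [].
apply: stein_stage => //.
- by move: nr; rewrite /k; lia.
- move=> j G; apply: stein_sol_le => // [i|]; last exact: cvg_poisson_centered.
  have /andP[a0 a1] : 0 <= avg (rate d) r h m.+1 (ncycles G) <= 1.
    by apply: avg01 => // l; exact: rate_ge1.
  have /andP[b0 b1] := f01 G i; rewrite ler_norml; apply/andP; split; lra.
- move=> j G H E; rewrite /g.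
  have -> : f G = f H.
    apply/funext => i; apply: avg_eq => // l lr; rewrite /upd.
    by case: eqP => // lk; apply: E; rewrite /k; lia.
  congr stein_sol; apply: avg_eq => // l lr; apply: E; rewrite /k; lia.
Qed.

Lemma telescope_error :
  `|\sum_(G : sgraph n | regular_graph d G)
      (h (ncycles G) - avg (rate d) r h (r - 2) (fun=> 0%N))|
    <= (\sum_(m < r - 2) stage_error (r - m)) * (nreg n d)%:R.
Proof.
have -> : \sum_(G : sgraph n | regular_graph d G)
      (h (ncycles G) - avg (rate d) r h (r - 2) (fun=> 0%N)) =
   \sum_(m < r - 2) \sum_(G : sgraph n | regular_graph d G)
      (avg (rate d) r h m (ncycles G) - avg (rate d) r h m.+1 (ncycles G)).
  rewrite exchange_big /=; apply: eq_bigr => G _.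
  rewrite -(big_mkord xpredT (fun m => avg (rate d) r h m (ncycles G) - avg (rate d) r h m.+1 (ncycles G))).
  rewrite (@telescope_sumr_eq _ 0 (r - 2) (fun i => - avg (rate d) r h i (ncycles G))) //.
    rewrite opprK [RHS]addrC; congr (_ - _).
    by apply: avg_eq => // i; lia.
  by move=> i _; rewrite opprK addrC.
apply: le_trans (ler_norm_sum _ _ _) _; rewrite mulr_suml; apply: ler_sum => m _.
exact: stage.
Qed.

End Telescoping.

(** * The law of the independent Poisson vector as an iterated average *)

Section PoissonLaw.
Context {R : realType} (r : nat) (lam : nat -> R).
Context {dT : measure_display} {T : measurableType dT} (P : probability T R).
Context (Z : nat -> {RV P >-> nat}) (A : set (nat -> nat)).
Hypothesis lam1 : forall k, (2 < k)%N -> 1 <= lam k.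
Hypothesis lawZ : forall k, (2 < k)%N -> has_Poisson_law (lam k) (Z k).
Hypothesis indepZ : mutually_independent [set k | (2 < k)%N] Z.
Hypothesis A_eq : forall w w' : nat -> nat,
  (forall i, (2 < i <= r)%N -> w i = w' i) -> A w -> A w'.

Definition indicA (w : nat -> nat) : R := (w \in A)%:R.

Definition cylinder k (w : nat -> nat) : set T :=
  [set t | (forall i, (2 < i <= k)%N -> Z i t = w i) /\ A (fun i => Z i t)].

Lemma indicA01 w : 0 <= indicA w <= 1.
Proof. by rewrite /indicA; case: (_ \in _); rewrite /= ?ler01 ?lexx. Qed.

Lemma measurable_preimage_nat k (B : set nat) : measurable (Z k @^-1` B).
Proof. by rewrite -[_ @^-1` _]setTI; exact: measurable_funP. Qed.

(** With all coordinates up to [r] fixed, membership in [A] is decided and independence gives the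
    product of point masses. Releasing the last fixed coordinate splits the event over its countably
    many values, and countable additivity yields the series that defines the next [avg]. No joint
    law on sequences has to be constructed. *)
Lemma cylinder_law m w : (m <= r - 2)%N ->
  measurable (cylinder (r - m) w) /\
  P (cylinder (r - m) w) =
    ((\prod_(i <- iota 3 (r - m - 2)) poisson_pmf (lam i) (w i)) *
     avg lam r indicA m w)%:E.
Proof.
elim: m w => [|m IH] w mr.
  rewrite subn0.
  pose J : {fset nat} := [fset i in iota 3 (r - 2)]%fset.
  have JE i : (i \in J) = (2 < i <= r)%N by rewrite !inE mem_iota; lia.
  pose B := \bigcap_(k in [set` J]) (Z k @^-1` [set w k]).
  have mB : measurable B.
    by apply: fin_bigcap_measurable => // i _; exact: measurable_preimage_nat.
  have PB : P B = (\prod_(i <- iota 3 (r - 2)) poisson_pmf (lam i) (w i))%:E.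
    rewrite indepZ; last by move=> i /=; rewrite JE => /andP[].
    rewrite -prodEFin.
    rewrite (perm_big (iota 3 (r - 2))) /=; last first.
      apply: uniq_perm; rewrite ?fset_uniq ?iota_uniq // => i.
      by rewrite !inE.
    rewrite big_seq [RHS]big_seq; apply: eq_bigr => i.
    by rewrite mem_iota => ir; apply: lawZ; lia.
  have BE t : B t <-> forall i, (2 < i <= r)%N -> Z i t = w i.
    split=> [Bt i ir|Bt i /=]; first by apply: Bt; rewrite /= JE.
    by rewrite JE => ir; apply: Bt.
  rewrite /= /indicA; have [/set_mem Aw|/negP nAw] := boolP (w \in A).
    have -> : cylinder r w = B.
      apply/seteqP; split => t; first by case=> h _; apply/BE.
      move=> Bt; split; first by apply/BE.
      by apply: A_eq Aw => i ir; apply/esym; move/BE: Bt; apply.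
    by rewrite mulr1.
  have -> : cylinder r w = set0.
    apply/seteqP; split => t // -[h At]; apply: nAw; apply/mem_set.
    exact: A_eq At.
  by rewrite measure0 mulr0.
set k := (r - m)%N.
have k2 : (2 < k)%N by rewrite /k; lia.
have Ek : (r - m.+1)%N = k.-1 by rewrite /k; lia.
have IHm j := IH (upd w k j) (ltnW mr).
rewrite Ek.
have cE : cylinder k.-1 w = \bigcup_j cylinder k (upd w k j).
  apply/seteqP; split => t.
    case=> h At; exists (Z k t) => //; split=> // i ik; rewrite /upd.
    by case: eqP => [->//|nik]; apply: h; lia.
  case=> j _ [h At]; split=> // i ik; rewrite h; last by lia.
  by rewrite /upd; case: eqP => // E; lia.
have mc : measurable (cylinder k.-1 w).
  by rewrite cE; apply: bigcup_measurable => j _; case: (IHm j).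
split=> //; rewrite cE measure_semi_bigcup; last 3 first.
- by move=> j; case: (IHm j).
- move=> i j _ _ [t [[h _] [h' _]]].
  by have := h k; have := h' k; rewrite /upd eqxx => <-; rewrite ?k2 ?leqnn // => <-; rewrite ?k2 ?leqnn.
- by rewrite -cE.
set Pi := \prod_(_ <- _) _.
have E j : P (cylinder k (upd w k j)) =
    (Pi * (poisson_pmf (lam k) j * avg lam r indicA m (upd w k j)))%:E.
  rewrite (IHm j).2 mulrA; congr (_ * _)%:E; rewrite -/k.
  have -> : (k - 2 = (k.-1 - 2).+1)%N by lia.
  rewrite -[(_.-1 - 2).+1]addn1 iotaD big_cat /= big_seq1 /upd.
  rewrite (_ : 3 + (k.-1 - 2) = k)%N; last by lia.
  rewrite eqxx; congr (_ * _); rewrite /Pi big_seq [RHS]big_seq.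
  apply: eq_bigr => i; rewrite mem_iota => ir.
  by rewrite (_ : i == k = false) //; lia.
rewrite (eq_eseriesr (g := fun j => (Pi * (poisson_pmf (lam k) j * avg lam r indicA m (upd w k j)))%:E)); last by move=> j _; exact: E.
have cv : cvgn (series (fun j => poisson_pmf (lam k) j * avg lam r indicA m (upd w k j))).
  apply: is_cvg_poisson_series; first exact: lam1.
  by move=> j; apply: avg01 => //; [exact: indicA01|exact: ltnW].
rewrite /= -/k.
have -> : Pi * limn (series (fun j => poisson_pmf (lam k) j * avg lam r indicA m (upd w k j))) =
  limn (fun N => Pi * series (fun j => poisson_pmf (lam k) j * avg lam r indicA m (upd w k j)) N).
  by apply/esym/cvg_lim => //; apply: cvgMr.
rewrite -EFin_lim; last by apply: is_cvgMr.
congr (limn _); apply/funext => N /=; rewrite sumEFin /series /= mulr_sumr.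
by [].
Qed.

Lemma poisson_vector_law :
  P [set t | A (fun i => Z i t)] = (avg lam r indicA (r - 2) (fun=> 0%N))%:E.
Proof.
have [_] := @cylinder_law (r - 2) (fun=> 0%N) (leqnn _).
rewrite (_ : r - (r - 2) - 2 = 0)%N; last by lia.
rewrite big_nil mul1r => <-; congr (P _).
by apply/seteqP; split => t => [At|[]//]; split=> // i; lia.
Qed.

End PoissonLaw.

(** * The law of the uniform regular graph as a finite average *)

Section RegularLaw.
Context {R : realType} (n d : nat).
Context {dT : measure_display} {T : measurableType dT} (P : probability T R).
Context (G : T -> sgraph n).
Hypothesis unifG : uniform_regular_graph P d G.

Lemma nregE : nreg n d = #|[pred h : sgraph n | regular_graph d h]|.
Proof.
rewrite /nreg -sum1_card [RHS]big_mkcond /=; apply: eq_bigr => H _.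
by rewrite inE; case: regular_graph.
Qed.

Lemma regular_law (B : set (sgraph n)) :
  P (G @^-1` B) =
  (\sum_(H : sgraph n | regular_graph d H) (H \in B)%:R / (nreg n d)%:R)%:E.
Proof.
have -> : G @^-1` B = \bigcup_(H in B) (G @^-1` [set H]).
  apply/seteqP; split => t /=; first by move=> Bt; exists (G t).
  by case=> H BH /= ->.
rewrite measure_fin_bigcup; last 3 first.
- exact: finite_finset.
- by move=> H H' _ _ [t [/= -> ->]].
- by move=> H _; have [] := unifG H.
pose s := index_enum (sgraph n : finType).
rewrite fsbig_mkcond (fsbigTE [fset H in s]%fset); last first.
  by move=> H; rewrite !inE mem_index_enum.
rewrite (perm_big s) /=; last first.
  apply: uniq_perm; rewrite ?fset_uniq ?index_enum_uniq // => H.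
  by rewrite !inE.
rewrite -sumEFin [RHS]big_mkcond; apply: eq_bigr => H _.
rewrite /patch; have [_ ->] := unifG H; rewrite nregE.
by case: (H \in B); case: (regular_graph d H); rewrite ?mul1r ?mul0r.
Qed.

(** If there were no regular graph, all point masses would vanish, against total mass 1. *)
Lemma nreg_gt0 : (0 < nreg n d)%N.
Proof.
have := regular_law setT; rewrite preimage_setT probability_setT => -[E].
rewrite lt0n; apply/eqP => n0; move: E; rewrite n0 invr0.
under eq_bigr do rewrite mulr0.
by rewrite big1 // => /eqP; rewrite oner_eq0.
Qed.

End RegularLaw.

Lemma dist_le1 (R : realFieldType) (x y : R) :
  0 <= x <= 1 -> 0 <= y <= 1 -> `|x - y| <= 1.
Proof.
by move=> /andP[? ?] /andP[? ?]; rewrite ler_norml; apply/andP; split; lra.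
Qed.

(** * Summing the stage errors *)

Section FinalBound.
Context {R : realType} (n r d : nat).
Local Notation b := (Num.sqrt ((d - 1)%:R : R)).

Lemma sqrt_deg_sqr : b ^+ 2 = (d - 1)%:R.
Proof. by rewrite sqr_sqrtr. Qed.

(** Powers of [b], the square root of [d - 1], replace half-integer exponents by natural ones. *)
Lemma powR_degE : (0 < r)%N -> (d - 1)%:R `^ (3 * r%:R / 2 - 1) = b ^+ (3 * r - 2).
Proof.
move=> r0; rewrite -powR_mulrn ?sqrtr_ge0 // -powR12_sqrt // -powRrM; congr (_ `^ _).
by rewrite natrB ?natrM; [field | lia].
Qed.

Hypotheses (n0 : (0 < n)%N) (r3 : (3 <= r)%N) (d3 : (3 <= d)%N).

Lemma sqrt_deg_ge1 : 1 <= b.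
Proof.
have := @ler_wsqrtr R 1 (d - 1)%:R; rewrite sqrtr1; apply.
by rewrite ler1n; lia.
Qed.

Lemma sqrt_rate k : (2 < k)%N ->
  Num.sqrt (rate d k : R) = b ^+ k / Num.sqrt (2 * k)%:R.
Proof.
move=> k2; have b1 := sqrt_deg_ge1.
have e0 : 0 <= b ^+ k / Num.sqrt (2 * k)%:R by rewrite divr_ge0 ?exprn_ge0 ?sqrtr_ge0.
rewrite -(ger0_norm e0) -sqrtr_sqr; congr Num.sqrt.
by rewrite expr_div_n -exprM mulnC exprM sqrt_deg_sqr sqr_sqrtr.
Qed.

(** In powers of [b] the Stein factor gives [b ^ (-k)] and the switching error [b ^ (4 k - 2)]. The
    constant is [5 * 30 = 150], multiplied by [3 / 2] as an upper bound for the square root of 2. *)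
Lemma stage_error_le k : (2 < k <= r)%N ->
  stage_error n d k <= 225 * Num.sqrt r%:R / n%:R * b ^+ (3 * k - 2).
Proof.
move=> /andP[k2 kr]; have b1 := sqrt_deg_ge1.
have b0 : 0 < b by exact: lt_le_trans b1.
have nR : 0 < n%:R :> R by rewrite ltr0n.
have sk0 : 0 < Num.sqrt (2 * k)%:R :> R by rewrite sqrtr_gt0 ltr0n; lia.
rewrite /stage_error sqrt_rate // invf_div.
have -> : (d - 1)%:R ^+ (2 * k - 1) = b ^+ (3 * k - 2) * b ^+ k :> R.
  rewrite -exprD (_ : 3 * k - 2 + k = 2 * (2 * k - 1))%N; last by lia.
  by rewrite exprM sqrt_deg_sqr.
have -> : 5 * (Num.sqrt (2 * k)%:R / b ^+ k) *
    (30 * (b ^+ (3 * k - 2) * b ^+ k) / n%:R) =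
    150 * Num.sqrt (2 * k)%:R / n%:R * b ^+ (3 * k - 2).
  have := exprn_gt0 k b0; move: (b ^+ k) (b ^+ (3 * k - 2)) => x y x0.
  by field; rewrite !gt_eqF.
rewrite ler_wpM2r ?exprn_ge0 ?sqrtr_ge0 // ler_wpM2r ?invr_ge0 //.
have s2 : Num.sqrt (2 * k)%:R <= 3 / 2 * Num.sqrt r%:R :> R.
  rewrite -(@ler_pXn2r _ 2) ?nnegrE ?mulr_ge0 ?sqrtr_ge0 //.
  rewrite exprMn !sqr_sqrtr // natrM.
  have : k%:R <= r%:R :> R by rewrite ler_nat.
  have : 0 <= k%:R :> R by [].
  by move=> ? ?; rewrite (_ : (3 / 2) ^+ 2 = 9 / 4 :> R); [lra | field].
by move: s2; lra.
Qed.

Lemma sum_half N : \sum_(m < N) (2^-1 : R) ^+ m <= 2.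
Proof.
suff -> : \sum_(m < N) (2^-1 : R) ^+ m = 2 - 2 * 2^-1 ^+ N.
  by rewrite lerBlDr lerDl mulr_ge0 // exprn_ge0 // invr_ge0.
elim: N => [|N IH]; first by rewrite big_ord0 expr0; ring.
by rewrite big_ord_recr /= IH exprS; field.
Qed.

(** Since [b ^ 3 >= 2], the bounds at least halve from each length to the next shorter one, so their
    sum is at most twice the bound for [r]. *)
Lemma sum_stage_error_le :
  \sum_(m < r - 2) stage_error n d (r - m) <=
  450 * Num.sqrt r%:R * b ^+ (3 * r - 2) / n%:R.
Proof.
have b1 := sqrt_deg_ge1; have b0 : 0 <= b by exact: sqrtr_ge0.
pose c : R := 225 * Num.sqrt r%:R / n%:R.
have c0 : 0 <= c by do !apply: mulr_ge0; rewrite ?invr_ge0 ?sqrtr_ge0 ?ler0n.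
have b3 : 2 <= b ^+ 3.
  rewrite exprS sqrt_deg_sqr; have : 2 <= (d - 1)%:R :> R by rewrite ler_nat; lia.
  by move: b1; nra.
apply: (@le_trans _ _ (\sum_(m < r - 2) c * b ^+ (3 * r - 2) * 2^-1 ^+ m)).
  apply: ler_sum => m _; have mr := ltn_ord m.
  apply: (le_trans (stage_error_le _)); first by lia.
  rewrite -/c -[leRHS]mulrA ler_wpM2l // exprVn ler_pdivlMr ?exprn_gt0 //.
  have -> : (3 * r - 2 = 3 * (r - m) - 2 + 3 * m)%N by lia.
  rewrite exprD ler_wpM2l ?exprn_ge0 // exprM.
  by rewrite lerXn2r ?nnegrE // exprn_ge0.
rewrite -mulr_sumr; apply: (@le_trans _ _ (c * b ^+ (3 * r - 2) * 2)).
  by rewrite ler_wpM2l ?sum_half // mulr_ge0 // exprn_ge0.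
by rewrite /c le_eqVlt; apply/orP; left; apply/eqP; field; rewrite pnatr_eq0; lia.
Qed.

(** Below the threshold [n] is at most linear in [r] and [d], hence at most [450 (d - 1) ^ r]; and
    [(d - 1) ^ r = b ^ (2 r) <= b ^ (3 r - 2)]. *)
Lemma trivial_bound : ~~ (4 * (2 * r + d) <= n)%N ->
  1 <= 450 * Num.sqrt r%:R * b ^+ (3 * r - 2) / n%:R.
Proof.
rewrite -ltnNge => nr; rewrite ler_pdivlMr ?ltr0n // mul1r.
have b1 := sqrt_deg_ge1.
have s1 : 1 <= Num.sqrt r%:R :> R by have := @ler_wsqrtr R 1 r%:R; rewrite sqrtr1; apply; rewrite ler1n; lia.
have h1 : (d - 1)%:R ^+ r <= b ^+ (3 * r - 2) :> R.
  have -> : (d - 1)%:R ^+ r = b ^+ (2 * r) :> R by rewrite exprM sqrt_deg_sqr.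
  by rewrite ler_weXn2l //; lia.
have h2 : (n <= 450 * (d - 1) ^ r)%N.
  have : (r.-1 < (d - 1) ^ r.-1)%N by rewrite ltn_expl; lia.
  rewrite -[in X in (_ <= _ * X)%N](prednK (_ : 0 < r)%N) ?expnS; last by lia.
  by move: ((d - 1) ^ r.-1)%N => X; nia.
apply: (@le_trans _ _ (450 * (d - 1)%:R ^+ r)).
  by rewrite -natrX -natrM ler_nat.
apply: (@le_trans _ _ (450 * b ^+ (3 * r - 2))).
  by apply: ler_wpM2l; [exact: ler0n | exact: h1].
apply: ler_wpM2r; first by apply: exprn_ge0; exact: sqrtr_ge0.
by apply: ler_peMr; [exact: ler0n | exact: s1].
Qed.

End FinalBound.

Theorem theorem11 (R : realType) :
  exists2 C : R, 0 < C &
  forall (n r d : nat), (1 <= n)%N -> (3 <= r)%N -> (3 <= d)%N ->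
    (odd d -> ~~ odd n) ->
  forall (d1 : measure_display) (T1 : measurableType d1)
    (P1 : probability T1 R) (G : T1 -> sgraph n),
    uniform_regular_graph P1 d G ->
  forall (d2 : measure_display) (T2 : measurableType d2)
    (P2 : probability T2 R) (Z : nat -> {RV P2 >-> nat}),
    (forall k, (3 <= k)%N ->
       has_Poisson_law ((d - 1)%:R ^+ k / (2 * k)%:R) (Z k)) ->
    mutually_independent [set k | (3 <= k)%N] Z ->
  (dTV P1 P2
     (fun w => [ffun i : 'I_(r - 2) => ncycles (G w) (i + 3)])
     (fun w => [ffun i : 'I_(r - 2) => Z (i + 3)%N w])
   <= (C * Num.sqrt r%:R * (d - 1)%:R `^ (3 * r%:R / 2 - 1) / n%:R)%:E)%E.
Proof.
(* [450 = 5 * 30 * (3 / 2) * 2]: the Stein factor, the switching error, the bound for the square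
   root of 2, and the geometric sum over the stages. *)
exists 450; first by rewrite ltr0n.
move=> n r d n1 r3 d3 _ d1 T1 P1 G unifG d2 T2 P2 Z lawZ indepZ.
rewrite powR_degE; last exact: ltn_trans r3.
apply: ge_ereal_sup => _ [A _ <-].
(* Sequences indexed by the cycle length itself replace the vectors with their shift by 3; [A'] sees
   only the coordinates from 3 to [r]. *)
pose A' := [set w : nat -> nat | A [ffun i : 'I_(r - 2) => w (i + 3)%N]].
have A'_eq (w w' : nat -> nat) :
    (forall i, (2 < i <= r)%N -> w i = w' i) -> A' w -> A' w'.
  move=> E; rewrite /A' /=; congr (A _); apply/ffunP => i; rewrite !ffunE.
  by apply: E; have := ltn_ord i; lia.
pose h : (nat -> nat) -> R := indicA A'.
have h01 w : 0 <= h w <= 1 by exact: indicA01.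
have h_eq w w' : (forall i, (2 < i <= r)%N -> w i = w' i) -> h w = h w'.
  move=> E; rewrite /h /indicA; congr (nat_of_bool _)%:R.
  by apply/idP/idP => /set_mem Aw; apply/mem_set; apply: A'_eq Aw => i ir; rewrite E.
have M0 := nreg_gt0 unifG.
have M0R : 0 < (nreg n d)%:R :> R by rewrite ltr0n.
set c := avg (rate d) r h (r - 2) (fun=> 0%N).
have c01 : 0 <= c <= 1 by apply: avg01 => // k; exact: rate_ge1.
have EP2 : P2 ((fun w => [ffun i : 'I_(r - 2) => Z (i + 3)%N w]) @^-1` A) = c%:E.
  by rewrite -(poisson_vector_law (fun k => @rate_ge1 R d k d3) lawZ indepZ A'_eq).
have EP1 : P1 ((fun w => [ffun i : 'I_(r - 2) => ncycles (G w) (i + 3)]) @^-1` A) =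
    (\sum_(H : sgraph n | regular_graph d H) h (ncycles H) / (nreg n d)%:R)%:E.
  exact: (regular_law unifG [set H | A' (ncycles H)]).
set a := \sum_(H | _) _ in EP1.
have sum_reg (x : R) : \sum_(H : sgraph n | regular_graph d H) x = (nreg n d)%:R * x.
  rewrite /nreg natr_sum mulr_suml big_mkcond; apply: eq_bigr => H _.
  by case: regular_graph; rewrite ?mul1r ?mul0r.
have a01 : 0 <= a <= 1.
  apply/andP; split.
    by apply: sumr_ge0 => H _; rewrite divr_ge0 //; case/andP: (h01 (ncycles H)).
  apply: (@le_trans _ _ (\sum_(H : sgraph n | regular_graph d H) (nreg n d)%:R^-1)).
    apply: ler_sum => H _; rewrite ler_piMl ?invr_ge0 //.
    by case/andP: (h01 (ncycles H)).
  by rewrite sum_reg divff // gt_eqF.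
rewrite EP1 EP2 -EFinB lee_fin.
have [nr|nr] := boolP (4 * (2 * r + d) <= n)%N; last first.
  exact: le_trans (dist_le1 a01 c01) (trivial_bound n1 r3 d3 nr).
have te := telescope_error n1 d3 nr h01 h_eq.
apply: le_trans (sum_stage_error_le n1 r3 d3).
rewrite -(ler_pM2r M0R); apply: le_trans te.
rewrite -{1}(gtr0_norm M0R) -normrM le_eqVlt; apply/orP; left; apply/eqP.
congr (`|_|); rewrite sumrB sum_reg mulrBl mulr_suml mulrC.
by congr (_ - _); apply: eq_bigr => H _; rewrite mulfVK // gt_eqF.
Qed.
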